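(* Let $(a,b,c)\in\mathcal{P}_{\mathrm{fin}}$ and let $\mathcal{A}^{a,b,c}=\{\mathcal{A}^{a,b,c}_i\}_{i\ge1}$ be the Airy wanderer line ensemble with parameters $(a,b,c)$. Then the following hold. (a) (Translation) For every $v\in\mathbb{R}$, the line ensemble $\left(\mathcal{A}^{a,b,c}_i(t)+v: i\ge1, t\in\mathbb{R}\right)$ has the same law as $\mathcal{A}^{\bar a,\bar b,\bar c}$, where $\bar a_i^{\pm}=a_i^{\pm}$, $\bar b_i^{\pm}=b_i^{\pm}$ for $i\ge1$, $\bar c^+=c^++v$ and $\bar c^-=0$. (b) (Reflection) The line ensemble $\left(\mathcal{A}^{a,b,c}_i(-t): i\ge1,t\in\mathbb{R}\right)$ has the same law as $\mathcal{A}^{b,a,c}$, i.e. the Airy wanderer line ensemble in which the $a$ and $b$ parameters have been swapped ($a_i^{\pm}$ and $b_i^{\pm}$ exchanged for all $i$) and with the same parameters $c^{\pm}$. (c) There exist $(\tilde a,\tilde b,\tilde c)\in\mathcal{P}_{\mathrm{pos}}$ and $\Delta\in\mathbb{R}$ such that $$\left(\mathcal{A}^{\tilde a,\tilde b,\tilde c}_i(t-\Delta)+c^+: i\ge1,t\in\mathbb{R}\right)\overset{d}{=}\left(\mathcal{A}^{a,b,c}_i(t): i\ge1,t\in\mathbb{R}\right).$$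
   Context: **Line ensembles.** $C(\mathbb{N}\times\mathbb{R})$ is the space of continuous functions on $\mathbb{N}\times\mathbb{R}$ ($\mathbb{N}=\{1,2,\dots\}$) with the topology of uniform convergence on compact sets and its Borel $\sigma$-algebra. A ($\mathbb{N}$-indexed) line ensemble $\mathcal{L}=\{\mathcal{L}_i\}_{i\ge1}$ on $\mathbb{R}$ is a random variable in $C(\mathbb{N}\times\mathbb{R})$, with $\mathcal{L}_i(t)=\mathcal{L}(i,t)$. **Brownian Gibbs property.** $\mathcal{L}$ has the Brownian Gibbs property if almost surely $\mathcal{L}_i(t)>\mathcal{L}_{i+1}(t)$ for all $i\ge1$, $t\in\mathbb{R}$, and for all real $s<r$ and integers $1\le k_1\le k_2$, with $K=\{k_1,\dots,k_2\}$, the conditional law of $\mathcal{L}|_{K\times[s,r]}$ given $\sigma\{\mathcal{L}_i(u):(i,u)\in(\mathbb{N}\times\mathbb{R})\setminus(K\times(s,r))\}$ is that of independent Brownian bridges $\{B_i\}_{i=k_1}^{k_2}$ on $[s,r]$ (diffusion parameter $1$) from $B_i(s)=\mathcal{L}_i(s)$ to $B_i(r)=\mathcal{L}_i(r)$, conditioned on $\mathcal{L}_{k_1-1}(u)>B_{k_1}(u)>\cdots>B_{k_2}(u)>\mathcal{L}_{k_2+1}(u)$ for all $u\in[s,r]$ (with $\mathcal{L}_0=\infty$). **Parameters.** Parameters $(a,b,c)$ consist of four sequences of non-negative reals $\{a_i^+\}_{i\ge1},\{a_i^-\}_{i\ge1},\{b_i^+\}_{i\ge1},\{b_i^-\}_{i\ge1}$,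 each non-increasing, with $\sum_{i\ge1}(a_i^++a_i^-+b_i^++b_i^-)<\infty$, and two reals $c^+,c^-$. Let $J_a^{\pm}=\inf\{k\ge1:a_k^{\pm}=0\}-1\in\{0,1,\dots\}\cup\{\infty\}$ and $J_b^{\pm}=\inf\{k\ge1:b_k^{\pm}=0\}-1$ (with $\inf\emptyset=\infty$). $\mathcal{P}_{\mathrm{fin}}$ is the set of parameters with $c^-=0$ and $J_a^-+J_b^-<\infty$; $\mathcal{P}_{\mathrm{pos}}\subset\mathcal{P}_{\mathrm{fin}}$ is the subset with $c^+=J_a^-=J_b^-=0$. If $a_1^-+b_1^->0$ or $c^-\ne0$, set $\underline a=\underline b=0$. Otherwise set $\underline a=1/a_1^+$ if $a_1^+>0$ and $\underline a=\infty$ if $a_1^+=0$; $\underline b=-1/b_1^+$ if $b_1^+>0$ and $\underline b=-\infty$ if $b_1^+=0$. **Kernel.** For $z\in\mathbb{C}\setminus\{0\}$ let $$\Phi_{a,b,c}(z)=e^{c^+z+c^-/z}\prod_{i=1}^\infty\frac{(1+b_i^+z)(1+b_i^-/z)}{(1-a_i^+z)(1-a_i^-/z)}.$$ For $x\in\mathbb{R}$ let $\Gamma_x^+=\{x+ye^{\pm \mathrm{i}\pi/4}:y\ge0\}$ and $\Gamma_x^-=\{x+ye^{\pm3\mathrm{i}\pi/4}:y\ge0\}$, both oriented in the direction of increasing imaginary part. For $t_1,t_2,x_1,x_2\in\mathbb{R}$ set $K_{a,b,c}=K^1_{a,b,c}+K^2_{a,b,c}+K^3_{a,b,c}$ (all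 evaluated at $(t_1,x_1;t_2,x_2)$), where $$K^1_{a,b,c}=\frac1{2\pi \mathrm{i}}\int_\gamma dw\, e^{(t_2-t_1)w^2+(t_1^2-t_2^2)w+w(x_2-x_1)+x_1t_1-x_2t_2-t_1^3/3+t_2^3/3},$$ $$K^2_{a,b,c}=-\frac{\mathbf 1\{t_2>t_1\}}{\sqrt{4\pi(t_2-t_1)}}\,e^{-\frac{(x_2-x_1)^2}{4(t_2-t_1)}-\frac{(t_2-t_1)(x_2+x_1)}2+\frac{(t_2-t_1)^3}{12}},$$ $$K^3_{a,b,c}=\frac1{(2\pi \mathrm{i})^2}\int_{\Gamma_\alpha^+}dz\int_{\Gamma_\beta^-}dw\,\frac{e^{z^3/3-x_1z-w^3/3+x_2w}}{z+t_1-w-t_2}\cdot\frac{\Phi_{a,b,c}(z+t_1)}{\Phi_{a,b,c}(w+t_2)},$$ with $\alpha,\beta\in\mathbb{R}$ any numbers such that $\alpha+t_1<\underline a$, $\beta+t_2>\underline b$. If $\Gamma^+_{\alpha+t_1}$ and $\Gamma^-_{\beta+t_2}$ have at most one intersection point, $\gamma=\emptyset$ and $K^1_{a,b,c}=0$; otherwise they have exactly two, complex conjugate, intersection points and $\gamma$ is the vertical segment joining them, oriented upward. The value of $K_{a,b,c}$ does not depend on the choice of $\alpha,\beta$. **Airy wanderer line ensemble.** For $(a,b,c)\in\mathcal{P}_{\mathrm{fin}}$ it is known that there is a unique (in law) line ensemble $\mathcal{A}^{a,b,c}=\{\mathcal{A}_i^{a,b,c}\}_{i\ge1}$ on $\mathbb{R}$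 such that: (i) for all $m\in\mathbb{N}$ and $s_1<\cdots<s_m$, the random measure $M(A)=\sum_{i\ge1}\sum_{j=1}^m\mathbf 1\{(s_j,\mathcal{A}_i^{a,b,c}(s_j))\in A\}$ is a determinantal point process on $\mathbb{R}^2$ with correlation kernel $K_{a,b,c}$ and reference measure (counting measure on $\{s_1,\dots,s_m\}$)$\times$Lebesgue; (ii) the line ensemble $\mathcal{L}^{a,b,c}$ defined by $\sqrt2\,\mathcal{L}^{a,b,c}_i(t)+t^2=\mathcal{A}^{a,b,c}_i(t)$ has the Brownian Gibbs property. *)

(* Defs.v *)
From HB Require Import structures.
From mathcomp Require Import all_boot all_order all_algebra.
From mathcomp Require Import all_classical all_reals all_analysis.
From mathcomp Require Import complex.

Set Implicit Arguments.
Unset Strict Implicit.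
Unset Printing Implicit Defensive.

Import Order.TTheory GRing.Theory Num.Theory.
Import numFieldNormedType.Exports.

Local Open Scope classical_set_scope.
Local Open Scope ring_scope.
Local Open Scope complex_scope.

(* Indices i = 1, 2, ... of curves and of parameter sequences are encoded by
   i - 1 : nat, so index 0 is the top curve, resp. the first term. *)

Section path_space.
Context {R : realType}.

Definition cts_curves := continuousType (nat * R)%type R.

HB.instance Definition _ := Choice.on cts_curves.
HB.instance Definition _ :=
  isPointed.Build cts_curves (cst (0 : R) : continuousType _ _).

Definition compact_cvg_topology : topologicalType :=
  initial_topology (id : cts_curves -> {family compact, (nat * R)%type -> R}).

(* C(N x R) with its Borel sigma-algebra *)
Definition curves := g_sigma_algebraType (@open compact_cvg_topology).

Lemma add_const_continuous (v : R) (f : curves) :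
  continuous (fun p : nat * R => f p + v).
Proof.
have cf : continuous f := @cts_fun _ _ (f : continuousType _ _).
by move=> p; apply: (@cvgD _ R^o _ _ _ f (cst v)); [exact: cf|exact: cvg_cst].
Qed.

Lemma reflect_continuous (f : curves) :
  continuous (fun p : nat * R => f (p.1, - p.2)).
Proof.
have cf : continuous f := @cts_fun _ _ (f : continuousType _ _).
move=> p; apply: continuous_comp; last exact: cf.
have c1 : x.1 @[x --> p] --> nbhs p.1 by exact: cvg_fst.
have c2 : - x.2 @[x --> p] --> nbhs (- p.2).
  by apply: (@cvgN _ R^o); exact: cvg_snd.
by apply: (cvg_pair c1 c2).
Qed.

Lemma delay_continuous (D : R) (f : curves) :
  continuous (fun p : nat * R => f (p.1, p.2 - D)).
Proof.
have cf : continuous f := @cts_fun _ _ (f : continuousType _ _).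
move=> p; apply: continuous_comp; last exact: cf.
have c1 : x.1 @[x --> p] --> nbhs p.1 by exact: cvg_fst.
have c2 : (x.2 - D) @[x --> p] --> nbhs (p.2 - D).
  by apply: (@cvgB _ R^o); [exact: cvg_snd|exact: cvg_cst].
by apply: (cvg_pair c1 c2).
Qed.

Definition add_const v f : curves :=
  mkcts (@add_const_continuous v f) : continuousType _ _.
Definition reflect_time f : curves :=
  mkcts (@reflect_continuous f) : continuousType _ _.
Definition delay D f : curves :=
  mkcts (@delay_continuous D f) : continuousType _ _.

End path_space.
Arguments cts_curves : clear implicits.
Arguments curves : clear implicits.

Definition same_law {R : realType} {d d'} {Omega : measurableType d}
    {Omega' : measurableType d'} (P : probability Omega R)
    (X : Omega -> curves R) (P' : probability Omega' R)
    (X' : Omega' -> curves R) : Prop :=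
  forall B, measurable B -> P (X @^-1` B) = P' (X' @^-1` B).

(* the sigma-algebra generated by the coordinates X_p, p in D *)
Definition sigma_coord {R : realType} {T I : Type} (X : T -> I -> R)
    (D : set I) : set (set T) :=
  <<s [set A | exists2 p, D p &
         exists2 Y, measurable Y & A = [set w | Y (X w p)]] >>.

(* the integral of f over B_1 x ... x B_n against the n-fold product of mu, for
   Bs = [:: B_1; ...; B_n], as an iterated integral *)
Fixpoint iter_integral {R : realType} {d} {T : measurableType d}
    (mu : set T -> \bar R) (Bs : seq (set T)) (f : seq T -> \bar R) : \bar R :=
  if Bs is B :: Bs' then
    (\int[mu]_(x in B) iter_integral mu Bs' (fun xs => f (x :: xs)))%E
  else f [::].

Section brownian_gibbs.
Context {R : realType}.

(* transition density of Brownian motion with diffusion parameter 1 *)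
Definition heat (t x : R) : R := normal_pdf 0 (Num.sqrt t) x.

(* heat (u_1 - u) (x_1 - x) * ... * heat (r - u_n) (y - x_n) *)
Fixpoint path_density (u x : R) (us xs : seq R) (r y : R) : R :=
  match us, xs with
  | u' :: us', x' :: xs' =>
      heat (u' - u) (x' - x) * path_density u' x' us' xs' r y
  | _, _ => heat (r - u) (y - x)
  end.

Definition is_brownian_bridge {d} {Omega : measurableType d}
    (P : probability Omega R) (s r x y : R) (X : Omega -> R -> R) : Prop :=
  [/\ forall u, measurable_fun [set: Omega] (fun w => X w u),
      forall w, {within `[s, r], continuous (X w)},
      forall w, X w s = x /\ X w r = y &
      forall (us : seq R) (Bs : nat -> set R),
        path <%R s (rcons us r) -> (forall k, measurable (Bs k)) ->
        P [set w | forall k, (k < size us)%N -> Bs k (X w us`_k)] =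
        iter_integral (@lebesgue_measure R) (mkseq Bs (size us))
          (fun xs => (path_density s x us xs r y / heat (r - s) (y - x))%:E)].

(* independent Brownian bridges (B_i), k1 <= i <= k2, from x_i to y_i *)
Definition are_independent_bridges {d} {Omega : measurableType d}
    (P : probability Omega R) (k1 k2 : nat) (s r : R) (x y : nat -> R)
    (B : Omega -> nat * R -> R) : Prop :=
  (forall i, (k1 <= i <= k2)%N ->
     is_brownian_bridge P s r (x i) (y i) (fun w u => B w (i, u))) /\
  (forall E : nat -> set Omega,
     (forall i, (k1 <= i <= k2)%N ->
        sigma_coord (fun w u => B w (i, u)) `[s, r] (E i)) ->
     P (\bigcap_(i in [set i | (k1 <= i <= k2)%N]) E i) =
     (\prod_(k1 <= i < k2.+1) P (E i))%E).

(* f_{k1-1} > b_{k1} > ... > b_{k2} > f_{k2+1} on [s, r]; there is no upper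
   barrier above the top curve *)
Definition avoiding (k1 k2 : nat) (s r : R) (f b : nat * R -> R) : Prop :=
  forall u, s <= u <= r ->
    [/\ (0 < k1)%N -> b (k1, u) < f (k1.-1, u),
        forall i, (k1 <= i < k2)%N -> b (i.+1, u) < b (i, u) &
        f (k2.+1, u) < b (k2, u)].

(* probability that B lies in H, conditionally on avoidance in environment f *)
Definition avoiding_prob {d} {Omega : measurableType d}
    (P : probability Omega R) (k1 k2 : nat) (s r : R) (f : nat * R -> R)
    (B : Omega -> nat * R -> R) (H : set (nat * R -> R)) : R :=
  fine (P [set w | avoiding k1 k2 s r f (B w) /\ H (B w)]) /
  fine (P [set w | avoiding k1 k2 s r f (B w)]).

(* The auxiliary space Omega' carries, for all endpoints x and y, a family
   B x y of independent bridges from x to y; only the law of each B x y enters.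
   The Borel sigma-algebra of C(K x [s, r]) is the one generated by the
   evaluations. *)
Definition brownian_gibbs {d} {Omega : measurableType d}
    (P : probability Omega R) (L : Omega -> nat * R -> R) : Prop :=
  {ae P, forall w, forall i t, L w (i.+1, t) < L w (i, t)} /\
  forall (s r : R) (k1 k2 : nat), s < r -> (k1 <= k2)%N ->
    let K := [set i | (k1 <= i <= k2)%N] in
    let outside := sigma_coord L (~` (K `*` `]s, r[)) in
    exists (d' : measure_display) (Omega' : measurableType d')
        (P' : probability Omega' R)
        (B : (nat -> R) -> (nat -> R) -> Omega' -> nat * R -> R),
      (forall x y, are_independent_bridges P' k1 k2 s r x y (B x y)) /\
      forall H, sigma_coord id (K `*` `[s, r]) H ->
        let Q w := avoiding_prob P' k1 k2 s r (L w)
                     (B (fun i => L w (i, s)) (fun i => L w (i, r))) H in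
        (forall Y, measurable Y -> outside (Q @^-1` Y)) /\
        (forall G, outside G ->
           P (G `&` [set w | H (L w)]) = (\int[P]_(w in G) (Q w)%:E)%E).

End brownian_gibbs.

Section determinantal.
Context {R : realType}.

Definition falling_factorial (x : \bar R) (n : nat) : \bar R :=
  (\prod_(k < n) (x - k%:R%:E))%E.

Definition kernel_det {T : zmodType} (K : T -> T -> R[i]) (xs : seq T) : R[i] :=
  \det (\matrix_(i < size xs, j < size xs) K xs`_i xs`_j).

(* M is a determinantal point process on R^2 with correlation kernel K and
   reference measure lam *)
Definition is_determinantal {d} {Omega : measurableType d}
    (P : probability Omega R) (M : Omega -> set (R * R) -> \bar R)
    (lam : set (R * R) -> \bar R) (K : R * R -> R * R -> R[i]) : Prop :=
  [/\ measurable_fun setT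
        (fun pq : (R * R) * (R * R) => complex.Re (K pq.1 pq.2)),
      measurable_fun setT
        (fun pq : (R * R) * (R * R) => complex.Im (K pq.1 pq.2)) &
      exists rho : seq (R * R) -> R,
        (forall xs, (rho xs)%:C = kernel_det K xs) /\
        forall (m : nat) (A : 'I_m -> set (R * R)) (n : 'I_m -> nat),
          (forall i, measurable (A i)) -> (forall i, bounded_set (A i)) ->
          trivIset setT A ->
          (\int[P]_w \prod_(i < m) falling_factorial (M w (A i)) (n i))%E =
          iter_integral lam (flatten [seq nseq (n i) (A i) | i <- enum 'I_m])
            (fun xs => (rho xs)%:E)].

End determinantal.

Section wanderer.
Context {R : realType}.

Local Notation C := (R[i] : numFieldType).

Record parameters := MkParams {
  ap : nat -> R; am : nat -> R; bp : nat -> R; bm : nat -> R;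
  cp : R; cm : R }.

Implicit Types (q : parameters) (a b : nat -> R).

Definition decreasing_nonneg a : Prop :=
  (forall i, 0 <= a i) /\ (forall i, a i.+1 <= a i).

Definition valid q : Prop :=
  [/\ decreasing_nonneg (ap q), decreasing_nonneg (am q),
      decreasing_nonneg (bp q), decreasing_nonneg (bm q) &
      (\sum_(0 <= i <oo) (ap q i + am q i + bp q i + bm q i)%:E < +oo)%E].

(* inf {k >= 1 : a_k = 0} - 1; the index shift absorbs the - 1 *)
Definition J a : \bar R := ereal_inf [set k%:R%:E | k in [set k | a k = 0]].

Definition Pfin q : Prop :=
  [/\ valid q, cm q = 0 & (J (am q) + J (bm q) < +oo)%E].

Definition Ppos q : Prop :=
  [/\ Pfin q, cp q = 0, J (am q) = 0%E & J (bm q) = 0%E].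

Definition lower_a q : \bar R :=
  if (0 < am q 0%N + bm q 0%N) || (cm q != 0) then 0%E
  else if 0 < ap q 0%N then ((ap q 0%N)^-1)%:E else +oo%E.

Definition lower_b q : \bar R :=
  if (0 < am q 0%N + bm q 0%N) || (cm q != 0) then 0%E
  else if 0 < bp q 0%N then (- (bp q 0%N)^-1)%:E else -oo%E.

Definition translate q (v : R) : parameters :=
  MkParams (ap q) (am q) (bp q) (bm q) (cp q + v) 0.

Definition swap_ab q : parameters :=
  MkParams (bp q) (bm q) (ap q) (am q) (cp q) (cm q).

Definition cexp (z : R[i]) : R[i] :=
  (expR (complex.Re z) * cos (complex.Im z)) +i*
  (expR (complex.Re z) * sin (complex.Im z)).

Definition Phi q (z : R[i]) : R[i] :=
  cexp ((cp q)%:C * z + (cm q)%:C / z) *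
  limn (fun n => \prod_(i < n)
    (((1 + (bp q i)%:C * z) * (1 + (bm q i)%:C / z)) /
     ((1 - (ap q i)%:C * z) * (1 - (am q i)%:C / z))) : C).

Definition cintegral {d} {T : measurableType d}
    (mu : {measure set T -> \bar R}) (D : set T) (f : T -> R[i]) : R[i] :=
  (\int[mu]_(x in D) complex.Re (f x)) +i* (\int[mu]_(x in D) complex.Im (f x)).

(* The wedge {x + y e^{+- i theta} : y >= 0} is parametrized over R by
   u |-> x + |u| e^{i sgn(u) theta}, whose imaginary part increases in u. *)
Definition wedge (theta x u : R) : R[i] :=
  x%:C + `|u|%:C * cexp (0 +i* (Num.sg u * theta)).
Definition dwedge (theta u : R) : R[i] :=
  (Num.sg u)%:C * cexp (0 +i* (Num.sg u * theta)).

Definition Gamma_plus : R -> R -> R[i] := wedge (pi / 4).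
Definition dGamma_plus : R -> R[i] := dwedge (pi / 4).
Definition Gamma_minus : R -> R -> R[i] := wedge (3 * pi / 4).
Definition dGamma_minus : R -> R[i] := dwedge (3 * pi / 4).

Definition crossing (x y : R) : set R[i] :=
  range (Gamma_plus x) `&` range (Gamma_minus y).

Definition two_pi_i : R[i] := 0 +i* (2 * pi).

(* gamma is the segment from the conjugate of p to p, for p the crossing point
   in the upper half plane *)
Definition K1 (alpha beta t1 x1 t2 x2 : R) : R[i] :=
  let X := crossing (alpha + t1) (beta + t2) in
  if `[< is_subset1 X >] then 0 else
  let p := xget 0 (X `&` [set z | 0 < complex.Im z]) in
  two_pi_i^-1 *
  cintegral (@lebesgue_measure R) `[- complex.Im p, complex.Im p]
    (fun y => let w := complex.Re p +i* y in
       cexp ((t2 - t1)%:C * w ^+ 2 + (t1 ^+ 2 - t2 ^+ 2)%:C * w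
             + w * (x2 - x1)%:C
             + (x1 * t1 - x2 * t2 - t1 ^+ 3 / 3 + t2 ^+ 3 / 3)%:C) * 'i).

Definition K2 (t1 x1 t2 x2 : R) : R :=
  if t1 < t2 then
    - (Num.sqrt (4 * pi * (t2 - t1)))^-1 *
    expR (- ((x2 - x1) ^+ 2 / (4 * (t2 - t1))) - (t2 - t1) * (x2 + x1) / 2
          + (t2 - t1) ^+ 3 / 12)
  else 0.

(* the double contour integral converges absolutely, hence is written against
   the product measure *)
Definition K3 q (alpha beta t1 x1 t2 x2 : R) : R[i] :=
  (two_pi_i ^+ 2)^-1 *
  cintegral (@lebesgue_measure R \x @lebesgue_measure R)%E setT
    (fun uv : R * R =>
       let z := Gamma_plus alpha uv.1 in
       let w := Gamma_minus beta uv.2 in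
       cexp (z ^+ 3 / 3 - x1%:C * z - w ^+ 3 / 3 + x2%:C * w)
       / (z + t1%:C - w - t2%:C)
       * (Phi q (z + t1%:C) / Phi q (w + t2%:C))
       * dGamma_plus uv.1 * dGamma_minus uv.2).

(* K = K_{a,b,c}: the defining formula holds for every admissible choice of the
   vertices alpha, beta, on which the value does not depend *)
Definition is_wanderer_kernel q (K : R -> R -> R -> R -> R[i]) : Prop :=
  forall t1 x1 t2 x2 alpha beta : R,
    ((alpha + t1)%:E < lower_a q)%E -> (lower_b q < (beta + t2)%:E)%E ->
    K t1 x1 t2 x2 = K1 alpha beta t1 x1 t2 x2 + (K2 t1 x1 t2 x2)%:C
                    + K3 q alpha beta t1 x1 t2 x2.

(* sum over i >= 1 and j of the unit mass at (s_j, A_i(s_j)) *)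
Definition point_process {d} {Omega : measurableType d}
    (A : Omega -> curves R) (s : seq R) (w : Omega) (E : set (R * R)) : \bar R :=
  (\sum_(0 <= i <oo) \sum_(j < size s) (\1_E (s`_j, A w (i, s`_j)))%:E)%E.

(* (counting measure on {s_1, ..., s_m}) x Lebesgue, for distinct s_j *)
Definition reference_measure (s : seq R) : set (R * R) -> \bar R :=
  (msum (fun j => \d_(s`_j)) (size s) \x @lebesgue_measure R)%E.

Definition is_airy_wanderer q {d} {Omega : measurableType d}
    (P : probability Omega R) (A : Omega -> curves R) : Prop :=
  [/\ measurable_fun setT A,
      exists K, is_wanderer_kernel q K /\
        forall s : seq R, (0 < size s)%N -> sorted <%R s ->
          is_determinantal P (point_process A s) (reference_measure s)
            (fun p p' => K p.1 p.2 p'.1 p'.2) &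
      brownian_gibbs P
        (fun w p => (A w p - p.2 ^+ 2) / Num.sqrt 2)].

End wanderer.
Arguments parameters : clear implicits.

(* The existence and uniqueness in law of the Airy wanderer line ensembles,
   which is what makes A^{a,b,c} well defined. *)
Definition airy_wanderers_well_defined (R : realType) : Prop :=
  forall q : parameters R, Pfin q ->
    (exists (d : measure_display) (Omega : measurableType d)
        (P : probability Omega R) (A : Omega -> curves R),
       is_airy_wanderer q P A) /\
    (forall (d : measure_display) (Omega : measurableType d)
        (P : probability Omega R) (A : Omega -> curves R)
        (d' : measure_display) (Omega' : measurableType d')
        (P' : probability Omega' R) (A' : Omega' -> curves R),
       is_airy_wanderer q P A -> is_airy_wanderer q P' A' ->
       same_law P A P' A').

(* Main.v *)
(* Each transformed ensemble is itself an Airy wanderer with the new parameters,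
   so the three statements follow from uniqueness in law.  The correlation kernel
   changes as follows; admissible contours go to admissible contours, so that none
   of them has to be deformed.
   - Adding v multiplies Phi by exp(v z), hence the kernel by exp(v (t1 - t2)),
     which does not affect determinants.
   - Since Phi_{b,a,c}(-z) = 1 / Phi_{a,b,c}(z), the substitution (z, w) -> (-w, -z)
     shows that reflecting time transposes the kernel and exchanges a and b.
   - Suppose c^+ = 0.  The poles of Phi are the 1/a_i^+ and the a_i^-, its zeros
     are the -1/b_i^+ and the -b_i^-, and at 0 there is a pole or a zero of
     multiplicity |J_a^- - J_b^-|.  A suitable small Delta separates the poles
     from the zeros, so that Phi(z) is, up to a constant factor, the function
     Phi'(z - Delta) of positive parameters.  The constant cancels in
     Phi(z + t1) / Phi(w + t2).
   The Gibbs property is transported by the same maps, because Brownian bridges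
   are invariant in law under adding affine functions and under time reversal. *)
Require Import Defs.
From HB Require Import structures.
From mathcomp Require Import all_boot all_order all_algebra.
From mathcomp Require Import all_classical all_reals all_analysis.
From mathcomp Require Import measurable_realfun.
From mathcomp Require Import complex.
From mathcomp Require Import ring lra zify.

Set Implicit Arguments.
Unset Strict Implicit.
Unset Printing Implicit Defensive.

Import Order.TTheory GRing.Theory Num.Theory.
Import numFieldNormedType.Exports.

Local Open Scope classical_set_scope.
Local Open Scope ring_scope.

(** * Change of variables *)

(** Changes of variables in iterated and contour integrals are made without measurability of the
    integrands: a bijection measurable in both directions acts directly on the supremum over simple
    functions. The exception is time reversal of a bridge, whose finite-dimensional laws are
    iterated integrals in chronological order; reversing that order requires Tonelli, hence joint
    measurability of the densities. In the third statement the factor exp (c^+ z) is removed by a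
    translation and restored at the end. The shifted identity for [Phi] can fail at 0 when minus
    parameters are present, but then [lower_a] and [lower_b] are both 0 and the contours miss the
    origin. The sign of Delta is dictated by the order at 0: a pole there must lie to the right of
    Delta, a zero to the left. What concerns zeros and [Gamma_minus] follows from what concerns
    poles and [Gamma_plus] by exchanging a and b and changing signs. *)

Section change_of_variables.
Import HBNNSimple.

Section simple_functions.
Context {d1 d2} {T1 : measurableType d1} {T2 : measurableType d2}
  {R : realType}.
Variables (phi : T1 -> T2) (psi : T2 -> T1).
Hypotheses (mphi : measurable_fun setT phi) (mpsi : measurable_fun setT psi).
Hypotheses (phiK : cancel phi psi) (psiK : cancel psi phi).
Variables (mu1 : set T1 -> \bar R) (mu2 : set T2 -> \bar R).
Hypothesis mu12 : forall E, measurable E -> mu1 (phi @^-1` E) = mu2 E.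

(** The level sets of [h \o phi] are the preimages of those of [h]. Plain set functions suffice, and
    [reference_measure] is given as one. *)
Lemma sintegral_comp (h : {nnsfun T2 >-> R}) :
  exists2 g : {nnsfun T1 >-> R}, g =1 h \o phi & sintegral mu1 g = sintegral mu2 h.
Proof.
have mg : measurable_fun setT (h \o phi).
  by apply: measurableT_comp => //.
have fg : finite_set (range (h \o phi)).
  apply: (@sub_finite_set _ _ (range h)) => [_ [x _ <-]|]; first by exists (phi x).
  exact: fimfunP.
have g0 x : 0 <= (h \o phi) x by exact: fun_ge0.
pose g : {nnsfun T1 >-> R} := HB.pack (h \o phi)
  (isMeasurableFun.Build _ _ _ _ _ mg) (FiniteImage.Build _ _ _ fg)
  (isNonNegFun.Build _ _ _ g0).
exists g => //; rewrite /sintegral; apply: eq_fsbigr => x _.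
by rewrite -mu12.
Qed.

End simple_functions.

(* The integral is a supremum over simple functions, so f need not be
   measurable. *)
Lemma integral_bij {d1 d2} {T1 : measurableType d1} {T2 : measurableType d2}
    {R : realType} (phi : T1 -> T2) (psi : T2 -> T1)
    (mu1 : set T1 -> \bar R) (mu2 : set T2 -> \bar R) :
  measurable_fun setT phi -> measurable_fun setT psi ->
  cancel phi psi -> cancel psi phi ->
  (forall E, measurable E -> mu1 (phi @^-1` E) = mu2 E) ->
  forall D (f : T2 -> \bar R),
  integral mu2 D f = integral mu1 (phi @^-1` D) (f \o phi).
Proof.
move=> mphi mpsi phiK psiK mu12 D f.
have mu21 E : measurable E -> mu2 (psi @^-1` E) = mu1 E.
  move=> mE; rewrite -mu12; last by rewrite -[X in measurable X]setTI; exact: mpsi.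
  by congr mu1; rewrite -comp_preimage; apply/seteqP; split=> x /=; rewrite phiK.
rewrite /integral.
have -> : (f \o phi) \_ (phi @^-1` D) = (f \_ D) \o phi.
  by [].

have key (g : T2 -> \bar R) :
  ereal_sup [set sintegral mu2 h | h in [set h : {nnsfun T2 >-> R} |
    forall x, ((h x)%:E <= g x)%E]] =
  ereal_sup [set sintegral mu1 h | h in [set h : {nnsfun T1 >-> R} |
    forall x, ((h x)%:E <= (g \o phi) x)%E]].
  congr ereal_sup; apply/seteqP; split => _ [h /= hg <-].
  - have [k kh <-] := sintegral_comp mphi mu12 h.
    by exists k => // x; rewrite kh /=.
  - have [k kh <-] := sintegral_comp mpsi mu21 h.
    by exists k => // x; rewrite kh /= -{2}(psiK x).
by rewrite funepos_comp funeneg_comp !key.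
Qed.

(** Multiplication by a finite positive number fixes both infinities, so it distributes even over
    the conventional value of an infinite difference. *)
Lemma mule_pfinBr {R : realType} (k : R) (x y : \bar R) : 0 < k ->
  (k%:E * (x - y) = k%:E * x - k%:E * y)%E.
Proof.
move=> k0; have k0' : (0 < k%:E)%E by rewrite lte_fin.
have ky := gt0_muley k0'; have kNy := gt0_muleNy k0'.
by case: x y => [x| |] [y| |]; rewrite ?(ky, kNy) //= -!EFinM ?ky ?kNy// -EFinB mulrBr.
Qed.

(** Scaling simple functions gives one inequality for every positive factor; the other is that
    inequality for [k^-1]. *)
Lemma integral_scale {d} {T : measurableType d} {R : realType}
  (mu : {measure set T -> \bar R}) D (f : T -> \bar R) (k : R) : 0 < k ->
  (\int[mu]_(x in D) (k%:E * f x) = k%:E * \int[mu]_(x in D) f x)%E.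
Proof.
move=> k0.
have key (l : R) (g : T -> \bar R) : 0 < l ->
  (l%:E * ereal_sup [set sintegral mu h | h in [set h : {nnsfun T >-> R} |
    forall x, ((h x)%:E <= g x)%E]] <=
  ereal_sup [set sintegral mu h | h in [set h : {nnsfun T >-> R} |
    forall x, ((h x)%:E <= l%:E * g x)%E]])%E.
  move=> l0; rewrite -lee_pdivlMl//; apply: ge_ereal_sup => _ [h /= hg <-].
  rewrite lee_pdivlMl//; apply: ereal_sup_ubound.
  exists (scale_nnsfun h (ltW l0)) => [x /=|].
    by rewrite EFinM lee_pmul2l// lte_fin.
  by rewrite -sintegralrM; apply: eq_sintegral.
have keyE (g : T -> \bar R) :
  (ereal_sup [set sintegral mu h | h in [set h : {nnsfun T >-> R} |
    forall x, ((h x)%:E <= k%:E * g x)%E]] =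
  k%:E * ereal_sup [set sintegral mu h | h in [set h : {nnsfun T >-> R} |
    forall x, ((h x)%:E <= g x)%E]])%E.
  apply/eqP; rewrite eq_le key// andbT -lee_pdivrMl//.
  have := key k^-1 (fun x => k%:E * g x)%E; rewrite invr_gt0 => /(_ k0).
  move/le_trans; apply; apply: ereal_sup_le => _ [h /= hg <-].
  by exists h => // x; have := hg x; rewrite muleA -EFinM mulVf ?gt_eqF// mul1e.
rewrite /integral.
have -> : (fun x => k%:E * f x)%E \_ D = (fun x => k%:E * (f \_ D) x)%E.
  by apply/funext => x; rewrite !patchE; case: ifP => // _; rewrite mule0.
rewrite ge0_funeposM ?ge0_funenegM ?ltW// !keyE.
by rewrite mule_pfinBr.
Qed.

End change_of_variables.

Section lebesgue_invariance.
Context {R : realType}.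
Local Notation mu := (@lebesgue_measure R).

(** Lebesgue measure is determined by half-open intervals, whose length a shift preserves. *)
Lemma lebesgue_measure_shift (c : R) (E : set (measurableTypeR R)) :
  measurable E -> mu ((fun x : measurableTypeR R => x + c) @^-1` E) = mu E.
Proof.
have mc : @measurable_fun _ _ (measurableTypeR R) (measurableTypeR R) setT
    (fun x => x + c).
  exact: measurable_funD.
move=> mE; apply/esym.
pose phi : {mfun measurableTypeR R >-> measurableTypeR R} :=
  HB.pack (fun x : measurableTypeR R => x + c : measurableTypeR R)
    (isMeasurableFun.Build _ _ (measurableTypeR R) (measurableTypeR R) _ mc).
rewrite (@lebesgue_measure_unique _ (pushforward mu phi))//.
move=> _ [[a b]] _ <-; rewrite /pushforward/=.
rewrite [X in _ = mu X](_ : _ = `]a - c, b - c]%classic); last first.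
  by apply/seteqP; split=> x /=; rewrite !in_itv/= ltrBlDr lerBrDr.
rewrite !lebesgue_measure_itv/= !lte_fin ltrD2r; case: ifP => // _.
by rewrite -!EFinB; congr EFin; lra.
Qed.

End lebesgue_invariance.

Lemma iter_integral_bij {d1 d2} {T1 : measurableType d1}
    {T2 : measurableType d2} {R : realType} (phi : T1 -> T2) (psi : T2 -> T1)
    (mu1 : set T1 -> \bar R) (mu2 : set T2 -> \bar R) :
  measurable_fun setT phi -> measurable_fun setT psi ->
  cancel phi psi -> cancel psi phi ->
  (forall E, measurable E -> mu1 (phi @^-1` E) = mu2 E) ->
  forall Bs (f : seq T2 -> \bar R),
  iter_integral mu2 Bs f =
  iter_integral mu1 [seq phi @^-1` B | B <- Bs] (fun xs => f (map phi xs)).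
Proof.
move=> mphi mpsi phiK psiK mu12; elim=> [//|B Bs IH] f /=.
rewrite (integral_bij mphi mpsi phiK psiK mu12).
by congr integral; apply/funext => x /=; rewrite IH.
Qed.

Section complex_integral.
Context {R : realType}.
Local Open Scope complex_scope.

Lemma eq_cintegral {d} {T : measurableType d} (mu : {measure set T -> \bar R})
    (D : set T) (f g : T -> R[i]) :
  {in D, f =1 g} -> cintegral mu D f = cintegral mu D g.
Proof. by move=> fg; congr (_ +i* _); apply: eq_Rintegral => x /fg ->. Qed.

Lemma cintegral_bij {d1 d2} {T1 : measurableType d1} {T2 : measurableType d2}
    (phi : T1 -> T2) (psi : T2 -> T1)
    (mu1 : {measure set T1 -> \bar R}) (mu2 : {measure set T2 -> \bar R}) :
  measurable_fun setT phi -> measurable_fun setT psi ->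
  cancel phi psi -> cancel psi phi ->
  (forall E, measurable E -> mu1 (phi @^-1` E) = mu2 E) ->
  forall D (f : T2 -> R[i]),
  cintegral mu2 D f = cintegral mu1 (phi @^-1` D) (f \o phi).
Proof.
move=> mphi mpsi phiK psiK mu12 D f.
by congr (_ +i* _); rewrite /Rintegral (integral_bij mphi mpsi phiK psiK mu12).
Qed.

Lemma cintegral_scale {d} {T : measurableType d}
    (mu : {measure set T -> \bar R}) (D : set T) (f : T -> R[i]) (k : R) :
  0 < k -> cintegral mu D (fun x => k%:C * f x) = k%:C * cintegral mu D f.
Proof.
(* [fine] sends both infinities to 0, so the factor comes out even where an integral is infinite. *)
move=> k0; have fineZ (x : \bar R) : fine (k%:E * x)%E = k * fine x.
  have k0' : (0 < k%:E)%E by rewrite lte_fin.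
  by case: x => [x| |] //; rewrite ?gt0_muley ?gt0_muleNy//= mulr0.
rewrite /cintegral /Rintegral.
rewrite [X in fine X +i* _](_ : _ = k%:E * \int[mu]_(x in D) (complex.Re (f x))%:E)%E.
  rewrite [X in _ +i* fine X](_ : _ = k%:E * \int[mu]_(x in D) (complex.Im (f x))%:E)%E.
    by rewrite !fineZ; apply/eqP; rewrite eq_complex /= !mul0r subr0 addr0 !eqxx.
  rewrite -integral_scale//; apply: eq_integral => x _.
  by case: (f x) => a b /=; rewrite mul0r addr0 EFinM.
rewrite -integral_scale//; apply: eq_integral => x _.
by case: (f x) => a b /=; rewrite mul0r subr0 EFinM.
Qed.

End complex_integral.

(** * Transport of the Brownian Gibbs property *)

(** The sets whose preimage lies in the target sigma-algebra form a sigma-algebra, so generators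
    suffice. *)
Lemma sigma_coord_preimage {R : realType} {T T' I I' : Type} (X : T -> I -> R)
    (X' : T' -> I' -> R) (D : set I) (D' : set I') (f : T -> T') :
  (forall p, D' p -> exists p0 (g : R -> R),
     [/\ D p0, measurable_fun setT g & forall w, X' (f w) p = g (X w p0)]) ->
  forall E, sigma_coord X' D' E -> sigma_coord X D (f @^-1` E).
Proof.
move=> h E; pose S := sigma_coord X D.
have [S0 SC SU] : sigma_algebra setT S by exact: smallest_sigma_algebra.
rewrite {1}/sigma_coord -/S; move: E.
apply: (@smallest_sub _ (sigma_algebra setT) _ [set E | S (f @^-1` E)]).
  split => [|A /= SA|A /= SA] /=.
  - by rewrite preimage_set0.
  - have -> : f @^-1` (setT `\` A) = setT `\` (f @^-1` A) by [].
    exact: SC.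
  - by rewrite preimage_bigcup; exact: SU.
move=> _ [p D'p [Y mY ->]] /=; have [p0 [g [Dp0 mg gE]]] := h p D'p.
apply: sub_sigma_algebra; exists p0 => //; exists (g @^-1` Y).
  by rewrite -[X in measurable X]setTI; exact: mg.
by apply/seteqP; split=> w /=; rewrite gE.
Qed.

(** All curves receive the same drift [l], which therefore drops out of every ordering condition. *)
Definition transport {R : realType} (sg l : R -> R) (f : nat * R -> R)
  (p : nat * R) : R := f (p.1, sg p.2) + l p.2.

(* The endpoint values e1 x y at s' and e2 x y at r' are those of the bridge on
   [s', r'] whose image by the time change runs from x to y; the time change may
   reverse the interval. *)
Definition carries_bridges {R : realType} (sg l : R -> R) (s r s' r' : R)
    (e1 e2 : R -> R -> R) : Prop :=
  [/\ s' < r',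
      (forall t, (s <= t <= r) = (s' <= sg t <= r')) /\
      (forall t, (s < t < r) = (s' < sg t < r')),
      forall f : R -> R,
        e1 (f (sg s) + l s) (f (sg r) + l r) = f s' /\
        e2 (f (sg s) + l s) (f (sg r) + l r) = f r' &
      forall d (Omega : measurableType d) (P : probability Omega R) x y X,
        is_brownian_bridge P s' r' (e1 x y) (e2 x y) X ->
        is_brownian_bridge P s r x y (fun w u => X w (sg u) + l u)].

Section gibbs_transfer.
Context {R : realType}.
Variables (sg ta l : R -> R).
Hypothesis taK : cancel ta sg.

Let measurable_shift (c : R) : measurable_fun setT (fun x : R => x + c).
Proof. exact: measurable_funD. Qed.

Lemma avoiding_transport k1 k2 (s r s' r' : R) (f b : nat * R -> R) :
  (forall t, (s <= t <= r) = (s' <= sg t <= r')) ->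
  avoiding k1 k2 s r (transport sg l f) (transport sg l b) <->
  avoiding k1 k2 s' r' f b.
Proof.
move=> H; split=> h u hu; last first.
  have [h1 h2 h3] := h (sg u) ltac:(by rewrite -H).
  rewrite /transport /=; split => [k|i k|]; rewrite ltrD2r; auto.
have [|] := h (ta u); first by rewrite H taK.
rewrite /transport /= taK => h1 h2 h3.
split => [k|i k|].
- by have := h1 k; rewrite ltrD2r.
- by have := h2 i k; rewrite ltrD2r.
- by move: h3; rewrite ltrD2r.
Qed.

Lemma independent_bridges_transport d (Omega : measurableType d)
    (P : probability Omega R) k1 k2 s r s' r' e1 e2 (x y : nat -> R) B :
  carries_bridges sg l s r s' r' e1 e2 ->
  are_independent_bridges P k1 k2 s' r'
    (fun i => e1 (x i) (y i)) (fun i => e2 (x i) (y i)) B ->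
  are_independent_bridges P k1 k2 s r x y (fun w => transport sg l (B w)).
Proof.
move=> [_ [Hc Ho] He Hb] [hB hI]; split=> [i ik|E hE].
  exact: Hb (hB i ik).
apply: hI => i ik; have := hE i ik; rewrite -[E i]/(id @^-1` E i).
apply: sigma_coord_preimage => u; rewrite /= in_itv/= Hc => hu.
by exists (sg u), (fun z => z + l u); split; rewrite ?in_itv.
Qed.

(** The map is deterministic and invertible, so both ensembles generate the same information outside
    corresponding windows. The new conditional law is the old one on the preimage of the event, with
    the bridges transported on the same auxiliary space. *)
Lemma gibbs_transfer d (Omega : measurableType d) (P : probability Omega R)
    (L : Omega -> nat * R -> R) :
  (forall s r, s < r -> exists s' r' e1 e2,
     carries_bridges sg l s r s' r' e1 e2) ->
  brownian_gibbs P L -> brownian_gibbs P (fun w => transport sg l (L w)).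
Proof.
move=> H [ord gibbs]; split.
  apply: filterS ord => w h i t; rewrite /transport/=.
  by rewrite ltrD2r.
move=> s r k1 k2 sr k12 K outside'.
have [s' [r' [e1 [e2 cb]]]] := H s r sr.
have [lt_sr [Hc Ho] He Hb] := cb.
have [d1 [Om1 [P1 [B [hB hQ]]]]] := gibbs s' r' k1 k2 lt_sr k12.
set outside := sigma_coord L (~` (K `*` `]s', r'[)) in hQ.
have o'o E : outside' E -> outside E.
  rewrite -[E]/(id @^-1` E) /outside' /outside; apply: sigma_coord_preimage.
  move=> [i t] /= hit; exists (i, sg t), (fun z => z + l t); split=> // hk.
  by apply: hit; move: hk; rewrite /= !in_itv/= Ho.
have oo' E : outside E -> outside' E.
  rewrite -[E]/(id @^-1` E) /outside' /outside; apply: sigma_coord_preimage.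
  move=> [i t] /= hit; exists (i, ta t), (fun z => z + - l (ta t)); split=> //.
    by move=> hk; apply: hit; move: hk; rewrite /= !in_itv/= Ho taK.
  by move=> w; rewrite /transport /= taK addrK.
exists d1, Om1, P1, (fun x y w => transport sg l
  (B (fun i => e1 (x i) (y i)) (fun i => e2 (x i) (y i)) w)); split.
  by move=> x y; exact: independent_bridges_transport cb (hB _ _).
move=> H0 mH0 Q0; pose H1 := transport sg l @^-1` H0.
have mH1 : sigma_coord id (K `*` `[s', r']) H1.
  apply: sigma_coord_preimage mH0 => -[i t] /= [Ki]; rewrite in_itv/= Hc => hu.
  by exists (i, sg t), (fun z => z + l t); split=> //; split => //=; rewrite in_itv.
have [Qm Qi] := hQ H1 mH1.
set Q1 := (Q in forall Y, measurable Y -> outside (Q @^-1` Y)) in Qm.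
(* [e1] and [e2] turn the transported boundary values back into those of [L] at [s'] and [r']. *)
have Q01 : Q0 = Q1.
  apply/funext => w; rewrite /Q0 /Q1 /avoiding_prob.
  set f1 := (fun i => e1 _ _); set f2 := (fun i => e2 _ _).
  have -> : f1 = (fun i => L w (i, s')).
    by apply/funext => i; have [<- _] := He (fun t => L w (i, t)).
  have -> : f2 = (fun i => L w (i, r')).
    by apply/funext => i; have [_ <-] := He (fun t => L w (i, t)).
  by congr (fine (P1 _) / fine (P1 _)); apply/seteqP; split=> v /=;
    rewrite (avoiding_transport _ _ _ _ Hc).
rewrite Q01; split=> [Y mY|G hG]; first by apply: oo'; exact: Qm.
by rewrite -Qi//; exact: o'o.
Qed.

End gibbs_transfer.

(** * Brownian bridges under delays and affine drifts *)

Lemma iter_integral_shift {R : realType} (cs : seq R) (Bs : seq (set R)) f :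
  size cs = size Bs ->
  iter_integral (@lebesgue_measure R) Bs f =
  iter_integral (@lebesgue_measure R)
    [seq (fun z => z + p.1) @^-1` p.2 | p <- zip cs Bs]
    (fun xs => f [seq p.1 + p.2 | p <- zip xs cs]).
Proof.
elim: cs Bs f => [|c cs IH] [|B Bs] f //= [sz].
pose phi (x : measurableTypeR R) : measurableTypeR R := x + c.
pose psi (x : measurableTypeR R) : measurableTypeR R := x - c.
have mphi : measurable_fun setT phi by exact: measurable_funD.
have mpsi : measurable_fun setT psi by exact: measurable_funD.
have phiK : cancel phi psi by move=> x; exact: addrK.
have psiK : cancel psi phi by move=> x; exact: subrK.
rewrite (integral_bij mphi mpsi phiK psiK (lebesgue_measure_shift c)).
by congr integral; apply/funext => x /=; rewrite (IH _ _ sz).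
Qed.

Lemma iter_integral_scale {R : realType} (k : R) (Bs : seq (set R)) f :
  0 < k ->
  iter_integral (@lebesgue_measure R) Bs (fun xs => k%:E * f xs)%E =
  (k%:E * iter_integral (@lebesgue_measure R) Bs f)%E.
Proof.
move=> k0; elim: Bs f => [//|B Bs IH] f /=.
by rewrite -integral_scale//; congr integral; apply/funext => x /=; rewrite IH.
Qed.

Section heat_kernel.
Context {R : realType}.
Implicit Types t x y : R.

Lemma heatE t x : 0 < t -> heat t x =
  normal_peak (Num.sqrt t) * expR (- (x ^+ 2 / (t *+ 2))).
Proof.
move=> t0; rewrite /heat normal_pdfE ?sqrtr_eq0 -?ltNge//.
by rewrite /normal_fun subr0 sqr_sqrtr ?ltW// mulNr.
Qed.

Lemma heat_gt0 t x : 0 < t -> 0 < heat t x.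
Proof.
by move=> t0; rewrite heatE// mulr_gt0 ?expR_gt0 ?normal_peak_gt0// sqrtr_eq0 -ltNge.
Qed.

Lemma heatN t x : 0 < t -> heat t (- x) = heat t x.
Proof. by move=> t0; rewrite !heatE// sqrrN. Qed.

(** Completing the square gives the Cameron-Martin factor of a drift; its exponent is additive over
    consecutive increments. *)
Lemma heat_drift (l t x : R) : 0 < t ->
  heat t (x + l * t) = heat t x * expR (- l * x - l ^+ 2 * t / 2).
Proof.
move=> t0; rewrite !heatE// -[RHS]mulrA -expRD; congr (_ * expR _).
by field; rewrite gt_eqF.
Qed.

Lemma measurable_heat t : measurable_fun setT (heat t).
Proof. exact: measurable_normal_pdf. Qed.

End heat_kernel.

Section affine_transport.
Context {R : realType}.

(** The drift factors of the increments multiply to one that depends only on the endpoints, which is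
    why they cancel in a bridge density. *)
Lemma path_density_affine (l m D : R) (us xs : seq R) (s r x y : R) :
  path <%R s (rcons us r) ->
  path_density s (x + (l * s + m)) us
    [seq p.1 + p.2 | p <- zip xs [seq l * u + m | u <- us]] r (y + (l * r + m)) =
  path_density (s - D) x [seq u - D | u <- us] xs (r - D) y *
    expR (- l * (y - x) - l ^+ 2 * (r - s) / 2).
Proof.
have step (t t' z z' : R) : t < t' ->
    heat (t' - t) (z' + (l * t' + m) - (z + (l * t + m))) =
    heat (t' - D - (t - D)) (z' - z) *
      expR (- l * (z' - z) - l ^+ 2 * (t' - t) / 2).
  move=> tt'; have -> : t' - D - (t - D) = t' - t by ring.
  rewrite -heat_drift ?subr_gt0//.
  by congr heat; ring.
elim: us xs s x => [|u us IH] [|z xs] s x //=.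
- by rewrite andbT; exact: step.
- by rewrite andbT; exact: step.
(* When [xs] runs out first, [path_density] steps from [s] directly to [r]. *)
- move=> /andP[su p]; apply: step; apply: lt_trans su _.
  by have /order_path_min := p; move/(_ lt_trans); rewrite all_rcons => /andP[].
- move=> /andP[su p]; rewrite IH// step// mulrACA -expRD.
  by congr (_ * _ * expR _); field.
Qed.

Lemma within_continuous_transport (sg l X : R -> R) (A A' : set R) :
  continuous sg -> continuous l -> (forall t, A t -> A' (sg t)) ->
  {within A', continuous X} -> {within A, continuous (fun t => X (sg t) + l t)}.
Proof.
move=> csg cl AA' /subspace_continuousP cX; apply/subspace_continuousP => x Ax.
apply: (@cvgD _ R^o); last first.
  by apply: cvg_trans (cl x); apply: cvg_app; exact: cvg_within.
apply: cvg_comp (cX _ (AA' _ Ax)) => P; rewrite /within /= => nP.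
have h : \forall t \near x, A' (sg t) -> P (sg t) := csg x _ nP.
by apply: filterS h => t /= Pt At; apply: Pt; exact: AA'.
Qed.

Lemma bridge_affine (l m D : R) d (Omega : measurableType d)
    (P : probability Omega R) (s r x y : R) X :
  is_brownian_bridge P (s - D) (r - D) (x - (l * s + m)) (y - (l * r + m)) X ->
  is_brownian_bridge P s r x y (fun w u => X w (u - D) + (l * u + m)).
Proof.
move=> [mX cX eX fX]; split.
- by move=> u; apply: measurable_funD => //; exact: mX.
- move=> w.
  apply: (@within_continuous_transport (fun u => u - D) (fun u => l * u + m)
    (X w) _ _ _ _ _ (cX w)).
  + by move=> u; apply: (@cvgB _ R^o); [exact: cvg_id|exact: cvg_cst].
  + move=> u; apply: (@cvgD _ R^o); last exact: cvg_cst.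
    by apply: (@cvgM _ R); [exact: cvg_cst|exact: cvg_id].
  + by move=> t /=; rewrite !in_itv/= !lerD2r.
- by move=> w; have [-> ->] := eX w; rewrite !subrK.
- move=> us Bs pus mBs.
  pose Bs' k : set R := (fun z => z + (l * us`_k + m)) @^-1` Bs k.
  have mBs' k : measurable (Bs' k).
    rewrite -[X in measurable X]setTI.
    by apply: (measurable_funD _ _ measurableT) => //; exact: measurable_id.
  pose us' := [seq u - D | u <- us].
  have szus' : size us' = size us by rewrite size_map.
  have nthus' k : (k < size us)%N -> us'`_k = us`_k - D.
    by move=> ks; rewrite (nth_map 0).
  have pus' : path <%R (s - D) (rcons us' (r - D)).
    rewrite -map_rcons; apply: (@homo_path _ _ (fun u => u - D) <%R) pus.
    by move=> a b; rewrite ltrD2r.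
  rewrite [X in P X](_ : _ = [set w | forall k, (k < size us')%N ->
     Bs' k (X w us'`_k)]); last first.
    apply/seteqP; split => w /= h k; rewrite ?szus' => ks.
      by rewrite /Bs' /= nthus'//; exact: h.
    by have := h k; rewrite /Bs' /= szus' nthus'//; apply.
  rewrite (fX _ _ pus' mBs') [RHS](@iter_integral_shift _ [seq l * u + m | u <- us]);
    last by rewrite size_map size_mkseq.
  congr iter_integral.
    apply: (@eq_from_nth _ set0).
      by rewrite size_mkseq szus' size_map size_zip size_map size_mkseq minnn.
    move=> k; rewrite size_mkseq szus' => ks.
    rewrite nth_mkseq// (nth_map (0, set0)).
      by rewrite nth_zip ?size_map ?size_iota//= (nth_map 0)// nth_mkseq.
    by rewrite size_zip size_map size_mkseq minnn.
  apply/funext => xs; congr EFin.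
  have := @path_density_affine l m D us xs s r (x - (l * s + m)) (y - (l * r + m)) pus.
  rewrite !subrK => ->.
  have sr : s < r.
    by have := order_path_min lt_trans pus; rewrite all_rcons => /andP[].
  (* Without intermediate times the same lemma treats the normalizing density, which acquires the
     same drift factor. *)
  have := @path_density_affine l m D [::] [::] s r (x - (l * s + m)) (y - (l * r + m)).
  rewrite /= !subrK andbT => /(_ sr) ->.
  rewrite opprB addrA subrK invfM mulrACA divff ?mulr1//.
  by rewrite gt_eqF// expR_gt0.
Qed.

End affine_transport.

(** * Brownian bridges under time reversal *)

Section bridge_reversal.
Context {R : realType}.
Local Notation mR := (measurableTypeR R).
Local Notation mu := (@lebesgue_measure R).

(** The finite-dimensional law of the bridge without its normalization; in this form the list of
    times can be cut at either end. *)
Definition bridge_mass (s x : R) (us : seq R) (Bs : seq (set R)) (r y : R)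
    : \bar R :=
  iter_integral mu Bs (fun xs => (path_density s x us xs r y)%:E).

Lemma path_lt (s r : R) us : path <%R s (rcons us r) -> s < r.
Proof.
by move=> /(order_path_min lt_trans); rewrite all_rcons => /andP[].
Qed.

Lemma path_density_ge0 (s x r y : R) us xs :
  path <%R s (rcons us r) -> 0 <= path_density s x us xs r y.
Proof.
elim: us xs s x => [|u us IH] [|z xs] s x /= p.
- by move: p; rewrite andbT => sr; rewrite ltW// heat_gt0// subr_gt0.
- by move: p; rewrite andbT => sr; rewrite ltW// heat_gt0// subr_gt0.
- by rewrite ltW// heat_gt0// subr_gt0 (path_lt (us := u :: us)).
- move: p => /andP[su p]; rewrite mulr_ge0 ?IH//.
  by rewrite ltW// heat_gt0// subr_gt0.
Qed.

Lemma iter_integral_ge0 (Bs : seq (set R)) (f : seq R -> \bar R) :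
  (forall xs, 0 <= f xs)%E -> (0 <= iter_integral mu Bs f)%E.
Proof.
elim: Bs f => [f f0|B Bs IH f f0] /=; first exact: f0.
by apply: integral_ge0 => z _; apply: IH => xs; exact: f0.
Qed.

Lemma bridge_mass_ge0 (s x r y : R) us Bs :
  path <%R s (rcons us r) -> (0 <= bridge_mass s x us Bs r y)%E.
Proof.
by move=> p; apply: iter_integral_ge0 => xs; rewrite lee_fin path_density_ge0.
Qed.

Lemma bridge_mass_cons (s x r y : R) u us (B : set R) Bs : s < u ->
  bridge_mass s x (u :: us) (B :: Bs) r y =
  (\int[mu]_(z in B) ((heat (u - s) (z - x))%:E * bridge_mass u z us Bs r y))%E.
Proof.
move=> su; rewrite /bridge_mass /=; congr integral; apply/funext => z.
by rewrite -iter_integral_scale// heat_gt0// subr_gt0.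
Qed.

Lemma measurable_heat_sub (t : R) d (T : measurableType d) (f g : T -> R) :
  measurable_fun setT f -> measurable_fun setT g ->
  measurable_fun setT (fun p => (heat t (f p - g p))%:E).
Proof.
move=> mf mg; apply/measurable_EFinP.
by apply: measurableT_comp (measurable_heat t) _; exact: measurable_funB.
Qed.

(** Tonelli requires joint measurability in the two endpoints when the last time is moved to the
    outermost integral. *)
Lemma measurable_bridge_mass (s r : R) us Bs :
  path <%R s (rcons us r) -> (forall k, measurable (nth set0 Bs k)) ->
  size us = size Bs ->
  measurable_fun setT (fun p : mR * mR => bridge_mass s p.1 us Bs r p.2).
Proof.
elim: us s Bs => [|u us IH] s [|B Bs] p mBs sz; try discriminate sz.
  rewrite /bridge_mass /=.
  exact: (@measurable_heat_sub (r - s) _ _ snd fst).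
move: p => /= /andP[su p]; move: sz => [sz].
have mB : measurable B := mBs 0%N.
pose f (q : (mR * mR) * mR) : \bar R :=
  (((heat (u - s) (q.2 - q.1.1))%:E * bridge_mass u q.2 us Bs r q.1.2) *
    (\1_B q.2)%:E)%E.
have -> : (fun q : mR * mR => bridge_mass s q.1 (u :: us) (B :: Bs) r q.2) =
    fubini_F mu f.
  apply/funext => q; rewrite bridge_mass_cons// integral_mkcond /fubini_F.
  apply: eq_integral => z _; rewrite patchE /f indicE /=.
  by case: ifP => _; rewrite ?mule1 ?mule0.
apply: measurable_fun_fubini_tonelli_F.
  apply: emeasurable_funM; first apply: emeasurable_funM.
  - apply: (@measurable_heat_sub (u - s) _ _ snd (fst \o fst)) => //.
    exact: measurableT_comp.
  - have h := IH _ _ p (fun k => mBs k.+1) sz.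
    apply: (@measurableT_comp _ _ _ _ _ _ _ _ (fun q : (mR * mR) * mR => (q.2, q.1.2)) h).
    by apply: measurable_fun_pair => //; exact: measurableT_comp.
  - apply/measurable_EFinP; apply: (@measurableT_comp _ _ _ _ _ _ (\1_B : mR -> R)).
      exact: measurable_indic.
    exact: measurable_snd.
move=> q; rewrite /f !mule_ge0 ?bridge_mass_ge0 ?lee_fin//.
by rewrite ltW// heat_gt0// subr_gt0.
Qed.

(** By definition the first time is integrated outermost; Tonelli brings the last one outside, with
    the restrictions written as indicators. *)
Lemma bridge_mass_rcons (s x r y : R) us u (Bs : seq (set R)) (B : set R) :
  path <%R s (rcons (rcons us u) r) ->
  (forall k, measurable (nth set0 Bs k)) -> measurable B ->
  size us = size Bs ->
  bridge_mass s x (rcons us u) (rcons Bs B) r y =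
  (\int[mu]_(z in B) ((heat (r - u) (y - z))%:E * bridge_mass s x us Bs u z))%E.
Proof.
elim: us s x Bs => [|v us IH] s x [|B1 Bs] p mBs mB sz; try discriminate sz.
  move: p => /= /andP[su _]; rewrite (@bridge_mass_cons s x r y u [::] B [::] su).
  by apply: eq_integral => z _; rewrite /bridge_mass/= muleC.
move: p => /= /andP[sv p]; move: sz => [sz].
have mB1 : measurable B1 := mBs 0%N.
have {}mBs k : measurable (nth set0 Bs k) := mBs k.+1.
have pvu : path <%R v (rcons us u).
  by move: p; rewrite rcons_path => /andP[].
have ur : u < r.
  by move: p; rewrite rcons_path last_rcons => /andP[].
pose f (q : mR * mR) : \bar R :=
  (((heat (v - s) (q.1 - x))%:E * (\1_B1 q.1)%:E) *
   (((heat (r - u) (y - q.2))%:E * (\1_B q.2)%:E) *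
     bridge_mass v q.1 us Bs u q.2))%E.
have f0 q : (0 <= f q)%E.
  rewrite /f !mule_ge0 ?bridge_mass_ge0 ?lee_fin//.
    by rewrite ltW// heat_gt0// subr_gt0.
  by rewrite ltW// heat_gt0// subr_gt0.
have mi (C : set R) (mC : measurable C) d (T : measurableType d) (g : T -> mR) :
    measurable_fun setT g -> measurable_fun setT (fun q => (\1_C (g q) : R)%:E).
  move=> mg; apply/measurable_EFinP.
  by apply: (@measurableT_comp _ _ _ _ _ _ (\1_C : mR -> R)).
have mf : measurable_fun setT f.
  apply: emeasurable_funM; apply: emeasurable_funM.
  - by apply: (@measurable_heat_sub (v - s) _ _ fst (cst x)).
  - exact: mi.
  - apply: emeasurable_funM; last exact: mi.
    by apply: (@measurable_heat_sub (r - u) _ _ (cst y) snd).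
  - exact: measurable_bridge_mass.
transitivity (\int[mu]_z1 \int[mu]_z f (z1, z))%E.
  rewrite (@bridge_mass_cons s x r y v _ B1 _ sv) integral_mkcond.
  apply: eq_integral => z1 _.
  rewrite patchE; case: ifPn => z1B; last first.
    rewrite integral0_eq// => z _.
    by rewrite /f /= indicE (negbTE z1B) mule0 mul0e.
  rewrite (IH v z1 Bs p mBs mB sz) integral_mkcond.
  have h : 0 < heat (v - s) (z1 - x) by rewrite heat_gt0// subr_gt0.
  rewrite -(integral_scale _ _ _ h); apply: eq_integral => z _.
  rewrite patchE /f /= !indicE z1B mule1.
  by case: ifP => _; rewrite ?mule1 ?mule0 ?mul0e ?mule0.
rewrite fubini_tonelli//.
rewrite [RHS]integral_mkcond; apply: eq_integral => z _.
rewrite patchE; case: ifPn => zB; last first.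
  rewrite integral0_eq// => z1 _.
  by rewrite /f /= [in X in (_ * (_ * X * _))%E]indicE (negbTE zB) mule0 mul0e mule0.
have h : 0 < heat (r - u) (y - z) by rewrite heat_gt0// subr_gt0.
rewrite (@bridge_mass_cons s x u z v us B1 Bs sv) -(integral_scale _ _ _ h).
rewrite [RHS]integral_mkcond.
apply: eq_integral => z1 _; rewrite patchE /f /= !indicE zB mule1.
case: ifP => _; last by rewrite !(mule0, mul0e).
by rewrite !mule1 muleCA.
Qed.

Lemma path_rev_opp (s r : R) us : path <%R s (rcons us r) ->
  path <%R (- r) (rcons (rev [seq - u | u <- us]) (- s)).
Proof.
move=> p; rewrite -map_rev -map_rcons -rev_cons.
apply: (@homo_path _ _ -%R (fun a b => b < a)); first by move=> a b; rewrite ltrN2.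
have := rev_path (fun a b : R => b < a) s (rcons us r).
by rewrite belast_rcons last_rcons => ->.
Qed.

(** [heat] is even, so a reversed path has the same product of transition densities; removing the
    first time on one side removes the last on the other. *)
Lemma bridge_mass_rev (s x r y : R) us (Bs : seq (set R)) :
  path <%R s (rcons us r) -> (forall k, measurable (nth set0 Bs k)) ->
  size us = size Bs ->
  bridge_mass (- r) y (rev [seq - u | u <- us]) (rev Bs) (- s) x =
  bridge_mass s x us Bs r y.
Proof.
elim: us s x Bs => [|u us IH] s x [|B Bs] p mBs sz; try discriminate sz.
  move: p; rewrite /= andbT => sr; rewrite /bridge_mass /= -heatN ?subr_gt0 ?ltrN2//.
  by congr (heat _ _)%:E; ring.
move: p => /= /andP[su p]; move: sz => [sz].
rewrite !rev_cons bridge_mass_rcons.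
- rewrite (@bridge_mass_cons s x r y u us B Bs su); apply: eq_integral => z _.
  rewrite (IH u z Bs p (fun k => mBs k.+1) sz).
  rewrite -heatN; last by rewrite subr_gt0 ltrN2.
  have -> : - (x - z) = z - x by ring.
  by have -> : - s - - u = u - s by ring.
- have /path_rev_opp : path <%R s (rcons (u :: us) r) by rewrite /= su.
  by rewrite /= rev_cons.
- move=> k; have [kB|] := ltnP k (size Bs); last first.
    by move=> kB; rewrite nth_default ?size_rev.
  by rewrite nth_rev//; exact: (mBs _.+1).
- exact: (mBs 0%N).
- by rewrite !size_rev size_map.
Qed.

Lemma bridge_reverse d (Omega : measurableType d)
    (P : probability Omega R) (s r x y : R) X : s < r ->
  is_brownian_bridge P (- r) (- s) y x X ->
  is_brownian_bridge P s r x y (fun w u => X w (- u)).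
Proof.
move=> sr [mX cX eX fX]; split.
- by move=> u; exact: mX.
- move=> w; have -> : (fun u => X w (- u)) = (fun u => X w (- u) + cst 0 u).
    by apply/funext => u; rewrite addr0.
  apply: (@within_continuous_transport _ -%R (cst 0) (X w) _ _ _ _ _ (cX w)).
  + by move=> u; apply: (@cvgN _ R^o); exact: cvg_id.
  + by move=> u; exact: cvg_cst.
  + by move=> t /=; rewrite !in_itv/= !lerN2 andbC.
- by move=> w; have [] := eX w.
- move=> us Bs pus mBs; set n := size us.
  pose us' := rev [seq - u | u <- us].
  (* All [Bs' k] must be measurable, hence the value [set0] beyond the last time. *)
  pose Bs' k := nth set0 (rev (mkseq Bs n)) k.
  have szus' : size us' = n by rewrite size_rev size_map.
  have Bs'E : mkseq Bs' (size us') = rev (mkseq Bs n).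
    by rewrite szus' -[in RHS](mkseq_nth set0 (rev _)) size_rev size_mkseq.
  have mnth k : measurable (nth set0 (mkseq Bs n) k).
    have [kn|kn] := ltnP k n; first by rewrite nth_mkseq.
    by rewrite nth_default// size_mkseq.
  have mBs' k : measurable (Bs' k).
    rewrite /Bs'; have [kn|kn] := ltnP k n.
      by rewrite nth_rev ?size_mkseq.
    by rewrite nth_default// size_rev size_mkseq.
  have nthus' k : (k < n)%N -> us'`_k = - us`_(n - k.+1).
    move=> kn; rewrite nth_rev ?size_map// (nth_map 0)//.
    by rewrite ltn_subrL (leq_trans _ kn).
  have nthBs' k : (k < n)%N -> Bs' k = Bs (n - k.+1)%N.
    move=> kn; rewrite /Bs' nth_rev ?size_mkseq// nth_mkseq//.
    by rewrite ltn_subrL (leq_trans _ kn).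
  rewrite [X in P X](_ : _ = [set w | forall k, (k < size us')%N ->
     Bs' k (X w us'`_k)]); last first.
    apply/seteqP; split => w /= h k; rewrite ?szus' => kn.
      by rewrite nthus'// nthBs'//; apply: h; rewrite ltn_subrL (leq_trans _ kn).
    have kn' : (n - k.+1 < n)%N by rewrite ltn_subrL (leq_trans _ kn).
    have := h (n - k.+1)%N; rewrite szus' nthus'// nthBs'//.
    rewrite subnSK// subKn ?(ltnW kn)//; apply; exact: leq_subr.
  rewrite (fX _ _ (path_rev_opp pus) mBs') Bs'E.
  have -> : heat (- s - - r) (x - y) = heat (r - s) (y - x).
    rewrite -heatN; last by rewrite subr_gt0 ltrN2.
    have -> : - (x - y) = y - x by ring.
    by have -> : - s - - r = r - s by ring.
  have k0 : 0 < (heat (r - s) (y - x))^-1 by rewrite invr_gt0 heat_gt0// subr_gt0.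
  have massE s' x' vs Cs r' y' : iter_integral mu Cs
      (fun xs => (path_density s' x' vs xs r' y' / heat (r - s) (y - x))%:E) =
      ((heat (r - s) (y - x))^-1%:E * bridge_mass s' x' vs Cs r' y')%E.
    rewrite -iter_integral_scale//; congr iter_integral; apply/funext => xs.
    by rewrite mulrC EFinM.
  by rewrite !massE bridge_mass_rev// size_mkseq.
Qed.

End bridge_reversal.

Lemma gibbs_affine {R : realType} (l m D : R) d (Omega : measurableType d)
    (P : probability Omega R) (L : Omega -> nat * R -> R) :
  brownian_gibbs P L ->
  brownian_gibbs P (fun w p => L w (p.1, p.2 - D) + (l * p.2 + m)).
Proof.
apply: (@gibbs_transfer _ (fun u => u - D) (fun u => u + D)
  (fun u => l * u + m)) => [u|s r sr]; first exact: addrK.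
exists (s - D), (r - D), (fun x _ => x - (l * s + m)), (fun _ y => y - (l * r + m)).
split=> //.
- by rewrite ltrD2r.
- by split=> t; rewrite !(lerD2r, ltrD2r).
- by move=> f; rewrite !addrK.
- by move=> d1 O1 P1 x y X; exact: bridge_affine.
Qed.

Lemma gibbs_reverse {R : realType} d (Omega : measurableType d)
    (P : probability Omega R) (L : Omega -> nat * R -> R) :
  brownian_gibbs P L -> brownian_gibbs P (fun w p => L w (p.1, - p.2)).
Proof.
move=> H; have -> : (fun w p => L w (p.1, - p.2)) =
    (fun w => transport -%R (cst 0) (L w)).
  by apply/funext => w; apply/funext => p; rewrite /transport addr0.
apply: (gibbs_transfer opprK _ H) => s r sr.
(* The bridge on [[- r, - s]] starts from the value prescribed at [r], so the endpoint maps exchange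
   their arguments. *)
exists (- r), (- s), (fun _ y => y), (fun x _ => x).
split=> //.
- by rewrite ltrN2.
- by split=> t; rewrite !(lerN2, ltrN2) andbC.
- by move=> f; rewrite !addr0.
- move=> d1 O1 P1 x y X /(bridge_reverse sr).
  by under [in X in _ -> X]eq_fun do under eq_fun do rewrite addr0.
Qed.

(** * Transport of determinantal point processes *)

Section determinantal_transfer.
Context {R : realType}.
Variables (sg ta : R -> R) (v c : R).
Hypotheses (sgK : cancel sg ta) (taK : cancel ta sg).
Hypotheses (msg : measurable_fun setT sg) (mta : measurable_fun setT ta).
Hypothesis sg_le : forall t, `|sg t| <= `|t| + c.

(** [phi] sends a point of [A'] at time [t] to the point of [A] at time [sg t] from which it
    arises. *)
Let phi (p : R * R) : R * R := (sg p.1, p.2 - v).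
Let psi (p : R * R) : R * R := (ta p.1, p.2 + v).

Let phiK : cancel phi psi.
Proof. by case=> t x; rewrite /phi /psi /= sgK subrK. Qed.

Let psiK : cancel psi phi.
Proof. by case=> t x; rewrite /phi /psi /= taK addrK. Qed.

Let mphi : measurable_fun setT phi.
Proof.
apply: measurable_fun_pair; first exact: measurableT_comp.
exact: measurable_funB.
Qed.

Let mpsi : measurable_fun setT psi.
Proof.
apply: measurable_fun_pair; first exact: measurableT_comp.
exact: measurable_funD.
Qed.

Lemma reference_measureE (s : seq R) (E : set (R * R)) : measurable E ->
  reference_measure s E = (\sum_(t <- s) (@lebesgue_measure R) (xsection E t))%E.
Proof.
move=> mE; rewrite /reference_measure /product_measure1.
rewrite ge0_integral_measure_sum//; last first.
  by apply: measurable_fun_xsection.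
rewrite (big_nth 0) big_mkord; apply: eq_bigr => j _.
rewrite integral_dirac ?diracT ?mul1e//.
exact: measurable_fun_xsection.
Qed.

(** Only a permutation is asked, because a reflected list of times must be reordered to be
    sorted. *)
Lemma reference_measure_transfer (s s' : seq R) (E : set (R * R)) :
  perm_eq s' (map sg s) -> measurable E ->
  reference_measure s (phi @^-1` E) = reference_measure s' E.
Proof.
move=> ss' mE; rewrite !reference_measureE//; last first.
  by rewrite -[X in measurable X]setTI; exact: mphi.
rewrite (perm_big _ ss') big_map; apply: eq_bigr => t _.
rewrite -[RHS](lebesgue_measure_shift (- v)); last exact: measurable_xsection.
by congr lebesgue_measure; apply/seteqP; split=> x; rewrite /xsection/= !inE.
Qed.

Lemma point_process_transfer d (Omega : measurableType d)
    (A A' : Omega -> curves R) (s s' : seq R) w E :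
  perm_eq s' (map sg s) ->
  (forall w i t, A' w (i, t) = A w (i, sg t) + v) ->
  point_process A' s w E = point_process A s' w (psi @^-1` E).
Proof.
move=> ss' AA'; rewrite /point_process; apply: eq_eseriesr => i _.
have bigE (B : Omega -> curves R) (u : seq R) F :
    (\sum_(j < size u) (\1_F (u`_j, B w (i, u`_j)))%:E =
     \sum_(t <- u) (\1_F (t, B w (i, t)) : R)%:E)%E.
  by rewrite (big_nth 0) big_mkord.
rewrite !bigE (perm_big _ ss') big_map; apply: eq_bigr => t _.
rewrite AA' !indicE; congr (_%:R)%:E; congr nat_of_bool.
by apply/idP/idP; rewrite !inE /psi /= sgK.
Qed.

(** Points, reference measure and test sets all move by [phi], and the correlation function becomes
    [rho \o map phi]. The bound on [sg] keeps the moved test sets bounded. *)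
Lemma determinantal_transfer d (Omega : measurableType d)
    (P : probability Omega R) (A A' : Omega -> curves R) (s s' : seq R)
    (K K' : R * R -> R * R -> R[i]) :
  perm_eq s' (map sg s) ->
  (forall w i t, A' w (i, t) = A w (i, sg t) + v) ->
  measurable_fun setT
    (fun pq : (R * R) * (R * R) => complex.Re (K' pq.1 pq.2)) ->
  measurable_fun setT
    (fun pq : (R * R) * (R * R) => complex.Im (K' pq.1 pq.2)) ->
  (forall xs, kernel_det K' xs = kernel_det K (map phi xs)) ->
  is_determinantal P (point_process A s') (reference_measure s') K ->
  is_determinantal P (point_process A' s) (reference_measure s) K'.
Proof.
move=> ss' AA' mRe mIm detE [_ _ [rho [rhoE H]]]; split=> //.
exists (rho \o map phi); split=> [xs|m B n mB bB tB]; first by rewrite /= rhoE detE.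
pose B' i := psi @^-1` B i.
have mB' i : measurable (B' i) by rewrite -[X in measurable X]setTI; exact: mpsi.
have bB' i : bounded_set (B' i).
  have /= := bB i; rewrite /bounded_set => /pinfty_ex_gt0[M M0 BM].
  exists (M + (`|c| + `|v|)); split=> [|N MN]; first exact: num_real.
  move=> p /BM; rewrite -{2}(psiK p); move: (psi p) => {p} [t x].
  rewrite /phi /= !prod_normE /= !ge_max => /andP[tM xM].
  apply/andP; split.
    apply: le_trans (sg_le t) _; apply: ltW; apply: le_lt_trans MN.
    by rewrite lerD// (le_trans (ler_norm c))// lerDl.
  apply: le_trans (ler_normB _ _) _; apply: ltW; apply: le_lt_trans MN.
  by rewrite lerD// lerDr.
have tB' : trivIset setT B'.
  move=> i j _ _ [p [pi pj]]; apply: (tB i j) => //.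
  by exists (psi p); split.
have := H m B' n mB' bB' tB'.
rewrite (iter_integral_bij mphi mpsi phiK psiK
  (fun E => @reference_measure_transfer s s' E ss')).
have -> : [seq phi @^-1` C | C <- flatten [seq nseq (n i) (B' i) | i <- enum 'I_m]] =
    flatten [seq nseq (n i) (B i) | i <- enum 'I_m].
  rewrite map_flatten -map_comp; congr flatten; apply: eq_map => i /=.
  rewrite map_nseq; congr nseq.
  by rewrite /B' -comp_preimage; apply/seteqP; split=> p; rewrite /= phiK.
move=> <-; apply: eq_integral => w _; apply: eq_bigr => i _.
by rewrite (@point_process_transfer _ _ A A' s s').
Qed.

End determinantal_transfer.

(** * Measurability of the curve transformations *)

Section curve_maps.
Context {R : realType}.
Local Notation path_topology := (@compact_cvg_topology R).
Local Notation target := {family compact, (nat * R)%type -> R}.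

(** Closeness of the images on a compact [K] is closeness of the originals on the compact image of
    [K] under [phi], as the constant cancels. *)
Lemma continuous_curve_map (T : curves R -> curves R)
    (phi : nat * R -> nat * R) (v : R) :
  continuous phi -> (forall f p, T f p = f (phi p) + v) ->
  continuous (T : path_topology -> path_topology).
Proof.
move=> cphi TE.
apply: (@continuous_comp_initial _ _ _ (id : cts_curves R -> target)
  (T : path_topology -> path_topology)) => f.
have cid : (id : path_topology -> target) @ f --> (f : target).
  exact: (@initial_continuous _ _ (id : cts_curves R -> target)).
have FF : Filter (@nbhs _ path_topology f) by exact: nbhs_filter.
have FT : Filter ((T : path_topology -> target) @ f) by exact: fmap_filter.
have FI : Filter ((id : path_topology -> target) @ f) by exact: fmap_filter.
apply/(@fam_cvgP _ _ compact _ (T f) FT) => K cK Q /uniform_nbhs[E [entE EQ]].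
move: entE; rewrite -entourage_ballE => -[e /= e0 eE].
have cK' : compact (phi @` K).
  by apply: continuous_compact => //; exact: continuous_subspaceT.
move/(@fam_cvgP _ _ compact _ _ FI) : cid => /(_ _ cK').
pose Q' : set {uniform` phi @` K -> R} :=
  [set h | forall y, (phi @` K) y -> ball ((f : nat * R -> R) y) e (h y)].
move=> /(_ Q') h.
have {}h : nbhs (f : path_topology) Q'.
  apply: h; apply/uniform_nbhs; exists [set xy | ball xy.1 e xy.2]; split=> //.
  exact: entourage_ball (PosNum e0).
apply: filterS h => g Q'g; apply: EQ => y Ky; apply: eE => /=.
have := Q'g (phi y) (ex_intro2 _ _ y Ky erefl).
by rewrite /= !TE /ball/= opprD addrACA subrr addr0.
Qed.

Lemma measurable_curve_map (T : curves R -> curves R)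
    (phi : nat * R -> nat * R) (v : R) :
  continuous phi -> (forall f p, T f p = f (phi p) + v) ->
  measurable_fun setT T.
Proof.
move=> cphi TE.
apply: (@measurability _ _ (curves R) (curves R) setT T (@open path_topology)) => //.
move=> _ [U oU <-]; apply: sub_sigma_algebra; rewrite setTI.
by have /continuousP := continuous_curve_map cphi TE; apply.
Qed.

End curve_maps.

Lemma measurable_add_const {R : realType} (v : R) : measurable_fun setT (@add_const R v).
Proof.
by apply: (@measurable_curve_map _ _ id v) => // p; exact: cvg_id.
Qed.

Lemma measurable_reflect_time {R : realType} : measurable_fun setT (@reflect_time R).
Proof.
apply: (@measurable_curve_map _ _ (fun p => (p.1, - p.2)) 0) => [p|f p].
  have c1 : x.1 @[x --> p] --> nbhs p.1 by exact: cvg_fst.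
  have c2 : - x.2 @[x --> p] --> nbhs (- p.2).
    by apply: (@cvgN _ R^o); exact: cvg_snd.
  exact: (cvg_pair c1 c2).
by rewrite addr0.
Qed.

Lemma measurable_delay {R : realType} (D : R) : measurable_fun setT (@delay R D).
Proof.
apply: (@measurable_curve_map _ _ (fun p => (p.1, p.2 - D)) 0) => [p|f p].
  have c1 : x.1 @[x --> p] --> nbhs p.1 by exact: cvg_fst.
  have c2 : (x.2 - D) @[x --> p] --> nbhs (p.2 - D).
    by apply: (@cvgB _ R^o); [exact: cvg_snd|exact: cvg_cst].
  exact: (cvg_pair c1 c2).
by rewrite addr0.
Qed.

(** * Symmetries of the kernel *)

Section contours.
Context {R : realType}.
Local Open Scope complex_scope.
Implicit Types x y u : R.

Lemma cexpD (a b : R[i]) : cexp (a + b) = cexp a * cexp b.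
Proof.
case: a b => [a1 a2] [b1 b2]; rewrite /cexp /= expRD cosD sinD.
by apply/eqP; rewrite eq_complex /=; apply/andP; split; apply/eqP; ring.
Qed.

Lemma cexp_real x : cexp x%:C = (expR x)%:C.
Proof. by rewrite /cexp /= cos0 sin0 mulr1 mulr0. Qed.

Lemma cexp0 : cexp (0 : R[i]) = 1.
Proof. by rewrite (cexp_real 0) expR0. Qed.

Lemma cexpV (a : R[i]) : (cexp a)^-1 = cexp (- a).
Proof.
have e : cexp a * cexp (- a) = 1 by rewrite -cexpD subrr cexp0.
have a0 : cexp a != 0.
  by apply/eqP => a0; move: e; rewrite a0 mul0r => /eqP; rewrite eq_sym oner_eq0.
by apply: (mulfI a0); rewrite divff.
Qed.

Definition h45 : R := cos (pi / 4).

Lemma sin_pi4 : sin (pi / 4) = h45.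
Proof.
rewrite /h45 -[in LHS](_ : pi / 2 - pi / 4 = pi / 4); last by field.
by rewrite sinB sin_pihalf cos_pihalf mul1r mul0r subr0.
Qed.

Lemma h45_gt0 : 0 < h45.
Proof.
apply: cos_gt0_pihalf; have := @pi_gt0 R; lra.
Qed.

Lemma cos_3pi4 : cos (3 * pi / 4) = - h45.
Proof.
have -> : 3 * pi / 4 = pi - pi / 4 :> R by field.
by rewrite cosB cospi sinpi mul0r addr0 mulN1r.
Qed.

Lemma sin_3pi4 : sin (3 * pi / 4) = h45.
Proof.
have -> : 3 * pi / 4 = pi - pi / 4 :> R by field.
by rewrite sinB cospi sinpi mul0r sub0r mulN1r opprK sin_pi4.
Qed.

Lemma cexp_sg u (th : R) : u != 0 ->
  cexp (0 +i* (Num.sg u * th)) = cos th +i* (Num.sg u * sin th).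
Proof.
move=> u0; rewrite /cexp /= expR0 !mul1r.
case: sgrP u0 => // _ _; first by rewrite !mul1r.
by rewrite !mulN1r cosN sinN.
Qed.

Lemma Gamma_plusE x u : Gamma_plus x u = (x + `|u| * h45) +i* (u * h45).
Proof.
rewrite /Gamma_plus /wedge; have [->|u0] := eqVneq u 0.
  by apply/eqP; rewrite eq_complex /= ?normr0 ?sgr0; apply/andP; split; apply/eqP; ring.
rewrite cexp_sg// sin_pi4 -/h45; apply/eqP; rewrite eq_complex /=.
apply/andP; split; apply/eqP; first by ring.
by rewrite [in RHS](numEsg u); ring.
Qed.

Lemma Gamma_minusE x u : Gamma_minus x u = (x - `|u| * h45) +i* (u * h45).
Proof.
rewrite /Gamma_minus /wedge; have [->|u0] := eqVneq u 0.
  by apply/eqP; rewrite eq_complex /= ?normr0 ?sgr0; apply/andP; split; apply/eqP; ring.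
rewrite cexp_sg// sin_3pi4 cos_3pi4; apply/eqP; rewrite eq_complex /=.
apply/andP; split; apply/eqP; first by ring.
by rewrite [in RHS](numEsg u); ring.
Qed.

Lemma dGamma_plusE u : dGamma_plus u = (Num.sg u * h45) +i* (Num.sg u ^+ 2 * h45).
Proof.
rewrite /dGamma_plus /dwedge; have [->|u0] := eqVneq u 0.
  by apply/eqP; rewrite eq_complex /= ?normr0 ?sgr0; apply/andP; split; apply/eqP; ring.
rewrite cexp_sg// sin_pi4 -/h45; apply/eqP; rewrite eq_complex /=.
by rewrite !mul0r subr0 addr0 expr2 mulrA !eqxx.
Qed.

Lemma dGamma_minusE u :
  dGamma_minus u = (- (Num.sg u * h45)) +i* (Num.sg u ^+ 2 * h45).
Proof.
rewrite /dGamma_minus /dwedge; have [->|u0] := eqVneq u 0.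
  by apply/eqP; rewrite eq_complex /= ?normr0 ?sgr0; apply/andP; split; apply/eqP; ring.
rewrite cexp_sg// sin_3pi4 cos_3pi4; apply/eqP; rewrite eq_complex /=.
by rewrite !mul0r subr0 addr0 mulrN expr2 mulrA !eqxx.
Qed.

Lemma Gamma_plusD x t u : Gamma_plus x u + t%:C = Gamma_plus (x + t) u.
Proof.
rewrite !Gamma_plusE; apply/eqP; rewrite eq_complex /=.
by apply/andP; split; apply/eqP; ring.
Qed.

Lemma Gamma_minusD x t u : Gamma_minus x u + t%:C = Gamma_minus (x + t) u.
Proof.
rewrite !Gamma_minusE; apply/eqP; rewrite eq_complex /=.
by apply/andP; split; apply/eqP; ring.
Qed.

Lemma Gamma_plusN x u : Gamma_plus (- x) (- u) = - Gamma_minus x u.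
Proof.
rewrite Gamma_plusE Gamma_minusE normrN; apply/eqP; rewrite eq_complex /=.
by apply/andP; split; apply/eqP; ring.
Qed.

Lemma Gamma_minusN x u : Gamma_minus (- x) (- u) = - Gamma_plus x u.
Proof. by rewrite -[in RHS](opprK x) -[in RHS](opprK u) Gamma_plusN opprK. Qed.

Lemma dGamma_plusN u : dGamma_plus (- u) = dGamma_minus u.
Proof. by rewrite dGamma_plusE dGamma_minusE sgrN mulNr sqrrN. Qed.

Lemma dGamma_minusN u : dGamma_minus (- u) = dGamma_plus u.
Proof. by rewrite -dGamma_plusN opprK. Qed.

(** Equal imaginary parts force the same parameter on both wedges, and the real parts then determine
    its absolute value. *)
Lemma crossingP x y z : crossing x y z <->
  2 * complex.Re z = x + y /\ 2 * `|complex.Im z| = y - x.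
Proof.
have h0 := h45_gt0; split.
  move=> [[u _ <-] [v _]]; rewrite Gamma_plusE Gamma_minusE.
  move=> /eqP; rewrite eq_complex /= => /andP[/eqP e1 /eqP e2].
  have uv : u = v by apply: (mulIf (lt0r_neq0 h0)).
  move: e1; rewrite uv => e1; rewrite normrM (gtr0_norm h0); split; lra.
move=> [e1 e2]; have hz : (complex.Im z / h45) * h45 = complex.Im z.
  by rewrite divfK// gt_eqF.
have nz : `|complex.Im z / h45| * h45 = `|complex.Im z|.
  by rewrite -{2}(gtr0_norm h0) -normrM hz.
by split; exists (complex.Im z / h45) => //; rewrite ?Gamma_plusE ?Gamma_minusE
  hz nz; apply/eqP; rewrite eq_complex /= eqxx andbT; apply/eqP; lra.
Qed.

Definition K1_integrand (t1 x1 t2 x2 : R) (w : R[i]) : R[i] :=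
  cexp ((t2 - t1)%:C * w ^+ 2 + (t1 ^+ 2 - t2 ^+ 2)%:C * w
             + w * (x2 - x1)%:C
             + (x1 * t1 - x2 * t2 - t1 ^+ 3 / 3 + t2 ^+ 3 / 3)%:C) * 'i.

(** The wedges meet twice exactly if [x < y], at the midpoint of the vertices plus or minus i times
    half their distance; this makes the choice by [xget] explicit. *)
Lemma K1E (alpha beta t1 x1 t2 x2 : R) :
  let x := alpha + t1 in let y := beta + t2 in
  K1 alpha beta t1 x1 t2 x2 =
  if x < y then two_pi_i^-1 *
    cintegral (@lebesgue_measure R) `[- ((y - x) / 2), (y - x) / 2]
      (fun s => K1_integrand t1 x1 t2 x2 (((x + y) / 2) +i* s))
  else 0.
Proof.
move=> x y; rewrite /K1 -/x -/y; move: x y => x y.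
case: asboolP => [sub|nsub]; case: ltP => // xy.
- exfalso; pose z e : R[i] := ((x + y) / 2) +i* (e * ((y - x) / 2)).
  have cz e : `|e| = 1 -> crossing x y (z e).
    move=> e1; apply/crossingP => /=; rewrite normrM e1 mul1r ger0_norm; last lra.
    by split; field.
  have /eqP := sub _ _ (cz 1 (normr1 _)) (cz (-1) (normrN1 _)).
  by rewrite eq_complex /= => /andP[_ /eqP]; lra.
- set p := xget _ _.
  have -> : p = ((x + y) / 2) +i* ((y - x) / 2).
    apply: xget_unique => [|[a b] [/crossingP/= [e1 e2] /= b0]].
      split => /=; last lra.
      by apply/crossingP => /=; rewrite ger0_norm; [split; field|lra].
    rewrite ger0_norm in e2; last lra.
    by apply/eqP; rewrite eq_complex /=; apply/andP; split; apply/eqP; lra.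
  by [].
- exfalso; apply: nsub => -[a b] [c e] /crossingP/= [e1 e2] /crossingP/= [e3 e4].
  have b0 : `|b| = 0 by have := normr_ge0 b; lra.
  have e0 : `|e| = 0 by have := normr_ge0 e; lra.
  move: b0 e0 => /normr0_eq0 -> /normr0_eq0 ->.
  by apply/eqP; rewrite eq_complex /= eqxx andbT; apply/eqP; lra.
Qed.

End contours.

(** * The three kernel summands under translation, delay and reflection *)

Section kernel_symmetries.
Context {R : realType}.
Local Open Scope complex_scope.
Implicit Types (v D t x alpha beta : R) (q : parameters R).

Lemma K1_integrand_translate v (t1 x1 t2 x2 : R) w :
  K1_integrand t1 x1 t2 x2 w =
  (expR (v * (t1 - t2)))%:C * K1_integrand t1 (x1 - v) t2 (x2 - v) w.
Proof.
rewrite /K1_integrand mulrA -cexp_real -cexpD; congr (cexp _ * _).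
case: w => a b; apply/eqP; rewrite eq_complex !expr2 /=.
by apply/andP; split; apply/eqP; ring.
Qed.

(* The exponent is (t2 - w)^3/3 - (t1 - w)^3/3 + x1 (t1 - w) - x2 (t2 - w). *)
Lemma K1_integrand_shift D (t1 x1 t2 x2 : R) a b :
  K1_integrand (t1 - D) x1 (t2 - D) x2 ((a - D) +i* b) =
  K1_integrand t1 x1 t2 x2 (a +i* b).
Proof.
rewrite /K1_integrand; congr (cexp _ * _).
apply/eqP; rewrite eq_complex !expr2 /=.
by apply/andP; split; apply/eqP; field.
Qed.

Lemma K1_integrand_swap (t1 x1 t2 x2 : R) w :
  K1_integrand (- t2) x2 (- t1) x1 (- w) = K1_integrand t1 x1 t2 x2 w.
Proof.
rewrite /K1_integrand; congr (cexp _ * _).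
case: w => a b; apply/eqP; rewrite eq_complex !expr2 /=.
by apply/andP; split; apply/eqP; field.
Qed.

Lemma K1_translate v alpha beta (t1 x1 t2 x2 : R) :
  K1 alpha beta t1 x1 t2 x2 =
  (expR (v * (t1 - t2)))%:C * K1 alpha beta t1 (x1 - v) t2 (x2 - v).
Proof.
rewrite !K1E; case: ifP => _; last by rewrite mulr0.
rewrite mulrCA -cintegral_scale ?expR_gt0//; congr (_ * _).
by apply: eq_cintegral => s _; exact: K1_integrand_translate.
Qed.

Lemma K1_shift D alpha beta (t1 x1 t2 x2 : R) :
  K1 alpha beta (t1 - D) x1 (t2 - D) x2 = K1 alpha beta t1 x1 t2 x2.
Proof.
rewrite !K1E (addrA alpha) (addrA beta) ltrD2r; case: ifP => // _; congr (_ * _).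
have -> : beta + t2 - D - (alpha + t1 - D) = beta + t2 - (alpha + t1) by ring.
have -> : (alpha + t1 - D + (beta + t2 - D)) / 2 =
  (alpha + t1 + (beta + t2)) / 2 - D by field.
by apply: eq_cintegral => s _; exact: K1_integrand_shift.
Qed.

(** The substitution w -> -w sends the segment to the one with opposite real part; [s -> - s]
    preserves its symmetric interval of integration. *)
Lemma K1_swap alpha beta (t1 x1 t2 x2 : R) :
  K1 (- beta) (- alpha) (- t2) x2 (- t1) x1 = K1 alpha beta t1 x1 t2 x2.
Proof.
rewrite !K1E -(opprD beta) -(opprD alpha) ltrN2; case: ifP => // _; congr (_ * _).
pose m := (beta + t2 - (alpha + t1)) / 2.
pose c := (alpha + t1 + (beta + t2)) / 2.
have -> : (- (alpha + t1) - - (beta + t2)) / 2 = m by rewrite /m; field.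
have -> : (- (beta + t2) + - (alpha + t1)) / 2 = - c by rewrite /c; field.
pose opp (s : measurableTypeR R) : measurableTypeR R := - s.
have mopp : measurable_fun setT opp by exact: oppr_measurable.
rewrite -/m -/c (@cintegral_bij _ _ _ _ _ opp opp _ lebesgue_measure mopp mopp
  opprK opprK (@lebesgue_measureN R)).
rewrite (_ : opp @^-1` _ = `[- m, m]%classic); last first.
  by apply/seteqP; split=> s /=; rewrite !in_itv/= lerN2 lerNl andbC.
by apply: eq_cintegral => s _ /=; rewrite -[RHS]K1_integrand_swap.
Qed.

Lemma K2_translate v (t1 x1 t2 x2 : R) :
  K2 t1 x1 t2 x2 = expR (v * (t1 - t2)) * K2 t1 (x1 - v) t2 (x2 - v).
Proof.
rewrite /K2; case: ifP => [tt|_]; last by rewrite mulr0.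
rewrite mulrCA -expRD; congr (_ * expR _); field.
by rewrite subr_eq0 gt_eqF.
Qed.

Lemma K2_shift D (t1 x1 t2 x2 : R) : K2 (t1 - D) x1 (t2 - D) x2 = K2 t1 x1 t2 x2.
Proof.
by rewrite /K2 ltrD2r; have -> : t2 - D - (t1 - D) = t2 - t1 by ring.
Qed.

Lemma K2_swap (t1 x1 t2 x2 : R) : K2 (- t2) x2 (- t1) x1 = K2 t1 x1 t2 x2.
Proof.
rewrite /K2 ltrN2; case: ifP => // tt.
have -> : - t1 - - t2 = t2 - t1 by ring.
by congr (_ * expR _); field; rewrite subr_eq0 gt_eqF.
Qed.

Definition K3_integrand q alpha beta (t1 x1 t2 x2 : R) (uv : R * R) : R[i] :=
  let z := Gamma_plus alpha uv.1 in
  let w := Gamma_minus beta uv.2 in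
  cexp (z ^+ 3 / 3 - x1%:C * z - w ^+ 3 / 3 + x2%:C * w)
  / (z + t1%:C - w - t2%:C)
  * (Phi q (z + t1%:C) / Phi q (w + t2%:C))
  * dGamma_plus uv.1 * dGamma_minus uv.2.

Lemma K3E q alpha beta (t1 x1 t2 x2 : R) :
  K3 q alpha beta t1 x1 t2 x2 = (two_pi_i ^+ 2)^-1 *
  cintegral (@lebesgue_measure R \x @lebesgue_measure R)%E setT
    (K3_integrand q alpha beta t1 x1 t2 x2).
Proof. by []. Qed.

(** The factor exp (v (z + t1) - v (w + t2)) from [Phi] splits into exp (v z - v w), which shifts
    both space variables by [v], and exp (v (t1 - t2)), which leaves the integral. *)
Lemma K3_translate q q' v alpha beta (t1 x1 t2 x2 : R) :
  (forall z, Phi q' z = cexp (v%:C * z) * Phi q z) ->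
  K3 q' alpha beta t1 x1 t2 x2 =
  (expR (v * (t1 - t2)))%:C * K3 q alpha beta t1 (x1 - v) t2 (x2 - v).
Proof.
move=> PhiE; rewrite !K3E mulrCA -cintegral_scale ?expR_gt0//; congr (_ * _).
apply: eq_cintegral => -[u u'] _; rewrite /K3_integrand /= !PhiE.
set z := Gamma_plus _ _; set w := Gamma_minus _ _.
move: (Phi q) => F; rewrite !invfM cexpV -cexp_real.
have -> : cexp (z ^+ 3 / 3 - x1%:C * z - w ^+ 3 / 3 + x2%:C * w) =
    cexp (v * (t1 - t2))%:C *
    cexp (z ^+ 3 / 3 - (x1 - v)%:C * z - w ^+ 3 / 3 + (x2 - v)%:C * w) *
    (cexp (- (v%:C * (z + t1%:C))) * cexp (v%:C * (w + t2%:C))).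
  by rewrite -!cexpD; congr cexp; rewrite !(rmorphM, rmorphB) /=; ring.
have e1 : cexp (- (v%:C * (z + t1%:C))) * cexp (v%:C * (z + t1%:C)) = 1.
  by rewrite -cexpD addNr cexp0.
have e2 : cexp (v%:C * (w + t2%:C)) * cexp (- (v%:C * (w + t2%:C))) = 1.
  by rewrite -cexpD subrr cexp0.
set X := cexp (z ^+ 3 / 3 - _ - _ + _).
set c1 := cexp (- (v%:C * (z + _))) in e1 *; set c2 := cexp (v%:C * (z + _)) in e1 *.
set c3 := cexp (v%:C * (w + _)) in e2 *; set c4 := cexp (- (v%:C * (w + _))) in e2 *.
set E := cexp _.
transitivity (E * X * (c1 * c2) * (c3 * c4) / (z + t1%:C - w - t2%:C) *
  (F (z + t1%:C) / F (w + t2%:C)) * dGamma_plus u * dGamma_minus u').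
  by ring.
by rewrite e1 e2; ring.
Qed.

(** The delayed times alone move the arguments of [Phi] by [D], so [alpha] and [beta] stay, and [k]
    cancels in the quotient. *)
Lemma K3_shift q q' D alpha beta (t1 x1 t2 x2 : R) (k : R[i]) : k != 0 ->
  (forall u, Phi q (Gamma_plus (alpha + t1) u) =
             k * Phi q' (Gamma_plus (alpha + t1) u - D%:C)) ->
  (forall u, Phi q (Gamma_minus (beta + t2) u) =
             k * Phi q' (Gamma_minus (beta + t2) u - D%:C)) ->
  K3 q alpha beta t1 x1 t2 x2 = K3 q' alpha beta (t1 - D) x1 (t2 - D) x2.
Proof.
move=> k0 Phip Phim; rewrite !K3E; apply: (congr1 (fun c => (two_pi_i ^+ 2)^-1 * c)).
apply: eq_cintegral => -[u u'] _; rewrite /K3_integrand /=.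
rewrite !Gamma_plusD !Gamma_minusD Phip Phim.
move: (Phi q') => F; rewrite -mulf_div divff// mul1r.
rewrite !addrA -[in RHS]Gamma_plusD -[in RHS]Gamma_minusD !rmorphN.
congr (_ / _ * _ * _ * _).
  by rewrite -!Gamma_plusD !rmorphB /=; ring.
Qed.

Lemma product_lebesgue_swapN (E : set (measurableTypeR R * measurableTypeR R)) :
  measurable E ->
  (@lebesgue_measure R \x @lebesgue_measure R)%E
    ((fun p : measurableTypeR R * measurableTypeR R => (- p.2, - p.1)) @^-1` E) =
  (@lebesgue_measure R \x @lebesgue_measure R)%E E.
Proof.
pose phi (p : measurableTypeR R * measurableTypeR R) :
  measurableTypeR R * measurableTypeR R := (- p.2, - p.1).
have mphi : measurable_fun setT phi.
  by apply: measurable_fun_pair; apply: measurableT_comp => //; exact: oppr_measurable.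
pose mfphi : {mfun (measurableTypeR R * measurableTypeR R)%type >->
    (measurableTypeR R * measurableTypeR R)%type} :=
  HB.pack phi (isMeasurableFun.Build _ _ _ _ _ mphi).
move=> mE; apply/esym/(@product_measure_unique _ _ _ _ _ _ _
  (pushforward (lebesgue_measure \x lebesgue_measure)%E mfphi)) => // A B mA mB.
have mN (C : set R) : measurable C -> measurable (-%R @^-1` C).
  by move=> mC; rewrite -[X in measurable X]setTI; exact: oppr_measurable.
transitivity ((@lebesgue_measure R) (-%R @^-1` B) *
  (@lebesgue_measure R) (-%R @^-1` A))%E; last first.
  by rewrite muleC; congr (_ * _)%E; exact: lebesgue_measureN.
rewrite -product_measure1E; [|exact: mN|exact: mN].
by congr product_measure1; apply/seteqP; split=> -[x y] /= [].
Qed.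

(** On the contour parameters the substitution (z, w) -> (-w, -z) is (u, u') -> (-u', -u), which
    also exchanges the derivatives of the two wedges. *)
Lemma K3_swap q q' alpha beta (t1 x1 t2 x2 : R) :
  (forall z, Phi q' (- z) = (Phi q z)^-1) ->
  K3 q (- beta) (- alpha) (- t2) x2 (- t1) x1 = K3 q' alpha beta t1 x1 t2 x2.
Proof.
move=> PhiE; rewrite !K3E; apply: (congr1 (fun c => (two_pi_i ^+ 2)^-1 * c)).
pose phi (p : measurableTypeR R * measurableTypeR R) :
  measurableTypeR R * measurableTypeR R := (- p.2, - p.1).
have mphi : measurable_fun setT phi.
  by apply: measurable_fun_pair; apply: measurableT_comp => //; exact: oppr_measurable.
have phiK : cancel phi phi by move=> [x y]; rewrite /phi /= !opprK.
rewrite (cintegral_bij mphi mphi phiK phiK product_lebesgue_swapN) preimage_setT.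
apply: eq_cintegral => -[u u'] _; rewrite /K3_integrand /phi /=.
rewrite Gamma_plusN Gamma_minusN dGamma_plusN dGamma_minusN.
move: (Phi q) (Phi q') PhiE => F F' FE.
set z := Gamma_plus _ _; set w := Gamma_minus _ _.
have -> : F (- w + (- t2)%:C) = (F' (w + t2%:C))^-1.
  by rewrite -[w + _]opprK FE invrK rmorphN -opprD.
have -> : F (- z + (- t1)%:C) = (F' (z + t1%:C))^-1.
  by rewrite -[z + _]opprK FE invrK rmorphN -opprD.
rewrite (_ : (- w) ^+ 3 / 3 - x2%:C * - w - (- z) ^+ 3 / 3 + x1%:C * - z =
  z ^+ 3 / 3 - x1%:C * z - w ^+ 3 / 3 + x2%:C * w); last by ring.
rewrite (_ : - w + (- t2)%:C - - z - (- t1)%:C = z + t1%:C - w - t2%:C);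
  last by rewrite !rmorphN; ring.
by rewrite invrK; ring.
Qed.

End kernel_symmetries.

(** * Infinite products *)

Section infinite_products.
Context {R : realType}.
Local Open Scope complex_scope.
Local Notation C := (R[i] : numFieldType).

(** The norm on [R[i]] is itself [R[i]]-valued; this is its real counterpart, for sums and bounds in
    [R]. *)
Definition cabs (z : R[i]) : R := complex.Re `|z|.

Lemma cabsE z : `|z| = (cabs z)%:C.
Proof. by rewrite /cabs; case: z => a b; rewrite normc_def. Qed.

Lemma cabs_ge0 z : 0 <= cabs z.
Proof. by rewrite -lecR -cabsE; exact: normr_ge0. Qed.

Lemma cabsM z w : cabs (z * w) = cabs z * cabs w.
Proof. by apply: complexI; rewrite rmorphM /= -!cabsE normrM. Qed.

Lemma cabsV z : cabs z^-1 = (cabs z)^-1.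
Proof. by apply: complexI; rewrite fmorphV /= -!cabsE normfV. Qed.

Lemma cabs_triangle z w : cabs (z + w) <= cabs z + cabs w.
Proof. by rewrite -lecR rmorphD /= -!cabsE ler_normD. Qed.

Lemma cabsN z : cabs (- z) = cabs z.
Proof. by apply: complexI; rewrite -!cabsE normrN. Qed.

Lemma cabs1 : cabs 1 = 1.
Proof. by apply: complexI; rewrite -cabsE normr1. Qed.

Lemma cabs_real (x : R) : 0 <= x -> cabs x%:C = x.
Proof. by move=> x0; apply: complexI; rewrite -cabsE ger0_norm// lecR. Qed.

Lemma cabs_Re z : `|complex.Re z| <= cabs z.
Proof. by rewrite -lecR -cabsE normc_ge_Re. Qed.

Lemma cabs_le z : cabs z <= `|complex.Re z| + `|complex.Im z|.
Proof.
case: z => a b /=; rewrite -lecR -cabsE normc_def lecR /=.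
rewrite -[leRHS]ger0_norm ?addr_ge0// -sqrtr_sqr ler_wsqrtr// sqrrD.
by rewrite !real_normK ?num_real// lerD2r lerDl mulrn_wge0// mulr_ge0.
Qed.

Lemma cabs_Im z : `|complex.Im z| <= cabs z.
Proof.
have -> : complex.Im z = complex.Re (- 'i * z) by case: z => a b /=; ring.
apply: le_trans (cabs_Re _) _; rewrite cabsM cabsN.
suff -> : cabs 'i = 1 by rewrite mul1r.
by apply: complexI; rewrite -cabsE normc_def /= expr0n expr1n add0r sqrtr1.
Qed.

Lemma complex_cvg (u : nat -> R[i]) (l : R[i]) :
  complex.Re (u n) @[n --> \oo] --> complex.Re l ->
  complex.Im (u n) @[n --> \oo] --> complex.Im l ->
  (u n : C) @[n --> \oo] --> (l : C).
Proof.
move=> /cvgrPdist_lt uRe /cvgrPdist_lt uIm.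
apply/(@cvgrPdist_lt C C) => e; rewrite ltcE /= => /andP[/eqP e1 e2].
have e20 : 0 < complex.Re e / 2 by rewrite divr_gt0.
near=> n; rewrite (cabsE (l - u n)) ltcE /= -e1 eqxx /=.
apply: le_lt_trans (cabs_le _) _; rewrite (splitr (complex.Re e)) ltrD//.
  by rewrite raddfB; near: n; exact: uRe.
by rewrite raddfB; near: n; exact: uIm.
Unshelve. all: by end_near. Qed.

Lemma bounded_variation_cvg (u : nat -> R) (M : R) :
  (forall n, \sum_(k < n) `|u k.+1 - u k| <= M) -> cvgn u.
Proof.
move=> uM; have h : cvgn [normed series (fun k => u k.+1 - u k)].
  apply: nondecreasing_is_cvgn.
    by apply: nondecreasing_series => k _ _; exact: normr_ge0.
  exists M => _ [n _ <-]; have := uM n.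
  by rewrite -(big_mkord xpredT (fun k => `|u k.+1 - u k|)).
have /cvg_ex[l hl] := @normed_cvg _ R^o _ h.
have -> : u = (fun n => series (fun k => u k.+1 - u k) n + u 0%N).
  by apply/funext => n; rewrite /series /= telescope_sumr// subrK.
apply: is_cvgD; last exact: is_cvg_cst.
exact: (@normed_cvg _ R^o _ h).
Qed.

Definition bounded_sums (a : nat -> R) : Prop :=
  exists M, forall n, \sum_(i < n) a i <= M.

Lemma bounded_sums_cvg0 (a : nat -> R) : (forall i, 0 <= a i) -> bounded_sums a ->
  a n @[n --> \oo] --> 0.
Proof.
move=> a0 [M aM]; apply: cvg_series_cvg_0; apply: nondecreasing_is_cvgn.
  by apply: nondecreasing_series => k _ _; exact: a0.
by exists M => _ [n _ <-]; rewrite /series /= big_mkord; exact: aM.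
Qed.

Lemma bounded_sums_le (a b : nat -> R) (N : nat) (k : R) : (forall i, 0 <= a i) ->
  (forall i, 0 <= b i) -> 0 <= k ->
  (forall i, (N <= i)%N -> b i <= k * a i) -> bounded_sums a -> bounded_sums b.
Proof.
move=> a0 b0 k0 ba [M aM]; exists (\sum_(i < N) b i + k * M) => n.
have aux : \sum_(i < n) b i <= \sum_(i < N) b i + \sum_(i < n) k * a i.
  elim: n => [|n IH]; first by rewrite !big_ord0 addr0 sumr_ge0.
  have [Nn|nN] := leqP N n.
    by rewrite !big_ord_recr /= addrA lerD// ba.
  apply: (@le_trans _ _ (\sum_(i < N) b i)).
    by rewrite (big_ord_widen N b nN)
      [leRHS](bigID (fun i : 'I_N => (i < n.+1)%N)) /= lerDl sumr_ge0.
  by rewrite lerDl sumr_ge0// => i _; rewrite mulr_ge0.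
by apply: le_trans aux _; rewrite lerD2l -mulr_sumr ler_wpM2l.
Qed.

Definition near_one (f : nat -> R[i]) : Prop := bounded_sums (fun i => cabs (f i - 1)).

(** Eventually |f_i| >= 1/2, and there |1/f_i - 1| <= 2 |f_i - 1|; the finitely many other terms
    only enlarge the bound. *)
Lemma near_one_inv (f : nat -> R[i]) : near_one f -> near_one (fun i => (f i)^-1).
Proof.
move=> sf; have /cvgrPdist_lt/(_ (1 / 2) ltac:(lra))[N _ hN] :=
  bounded_sums_cvg0 (fun i => cabs_ge0 (f i - 1)) sf.
apply: (@bounded_sums_le _ _ N 2 _ _ _ _ sf) => // [i|i|i Ni]; try exact: cabs_ge0.
have := hN i Ni; rewrite /= sub0r normrN ger0_norm ?cabs_ge0// => h.
have f12 : 1 / 2 <= cabs (f i).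
  have := cabs_triangle (f i) (- (f i - 1)).
  by rewrite opprB addrC subrK cabs1 -opprB cabsN; lra.
have f0 : f i != 0.
  apply/eqP => f0; move: f12; rewrite f0.
  have -> : cabs 0 = 0 by apply: complexI; rewrite -cabsE normr0.
  lra.
have -> : (f i)^-1 - 1 = - (f i - 1) / f i by field.
rewrite cabsM cabsN cabsV mulrC ler_wpM2r ?cabs_ge0//.
by rewrite -[leRHS]invrK lef_pV2 ?posrE; lra.
Qed.

Definition hasprod (f : nat -> R[i]) (l : R[i]) : Prop :=
  (fun n => \prod_(i < n) f i : C) @ \oo --> (l : C).

(** Since |f_i| <= exp |f_i - 1|, the partial products stay below exp M, so their increments are
    absolutely summable. *)
Lemma hasprod_ex (f : nat -> R[i]) : near_one f -> exists l, hasprod f l.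
Proof.
move=> [M fM]; pose u n := \prod_(i < n) f i.
have uM n : cabs (u n) <= expR M.
  apply: (@le_trans _ _ (expR (\sum_(i < n) cabs (f i - 1)))); last first.
    by rewrite ler_expR.
  elim: n => [|n IH]; first by rewrite /u !big_ord0 cabs1 expR0.
  rewrite /u !big_ord_recr /= cabsM expRD ler_pM ?cabs_ge0//.
  apply: le_trans (expR_ge1Dx _).
  by have := cabs_triangle 1 (f n - 1); rewrite cabs1 addrCA subrr addr0.
have du n : \sum_(k < n) cabs (u k.+1 - u k) <= expR M * M.
  apply: (@le_trans _ _ (\sum_(k < n) expR M * cabs (f k - 1))).
    apply: ler_sum => k _.
    have -> : u k.+1 - u k = u k * (f k - 1).
      by rewrite {1}/u big_ord_recr /= -/(u k); ring.
    by rewrite cabsM ler_wpM2r ?cabs_ge0.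
  by rewrite -mulr_sumr ler_wpM2l ?expR_ge0.
have /cvg_ex[a ha] : cvgn (fun n => complex.Re (u n)).
  apply: (@bounded_variation_cvg _ (expR M * M)) => n; apply: le_trans (du n).
  by apply: ler_sum => k _; rewrite /= -raddfB cabs_Re.
have /cvg_ex[b hb] : cvgn (fun n => complex.Im (u n)).
  apply: (@bounded_variation_cvg _ (expR M * M)) => n; apply: le_trans (du n).
  by apply: ler_sum => k _; rewrite /= -raddfB cabs_Im.
by exists (a +i* b); apply: complex_cvg.
Qed.

End infinite_products.

Lemma numField_cvg_lim (K : numFieldType) (u : nat -> K) (l : K) :
  u @ \oo --> l -> limn u = l.
Proof. by move=> h; apply: (cvg_lim _ h); exact: norm_hausdorff. Qed.

Lemma numField_cvgM (K : numFieldType) (u v : nat -> K) (l m : K) :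
  u @ \oo --> l -> v @ \oo --> m -> (fun n => u n * v n) @ \oo --> l * m.
Proof. exact: cvgM. Qed.

Lemma numField_cvg_near (K : numFieldType) (u v : nat -> K) (l : K) (N : nat) :
  (forall n, (N <= n)%N -> v n = u n) -> u @ \oo --> l -> v @ \oo --> l.
Proof.
move=> h; apply: cvg_trans; apply: near_eq_cvg.
by exists N => // n /= /h ->.
Qed.

Lemma numField_cvg_shift (K : numFieldType) (u : nat -> K) (l : K) :
  u @ \oo --> l -> (fun n => u n.-1) @ \oo --> l.
Proof. by move=> h; rewrite -cvg_shiftS. Qed.

Lemma numField_cvg_cst (K : numFieldType) (l : K) :
  (fun _ : nat => l) @ \oo --> l.
Proof. exact: cvg_cst. Qed.

Section product_rules.
Context {R : realType}.
Local Open Scope complex_scope.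
Local Notation C := (R[i] : numFieldType).
Implicit Types f g : nat -> R[i].

Lemma hasprod_lim f (l : R[i]) :
  hasprod f l -> limn (fun n => \prod_(i < n) f i : C) = l.
Proof. exact: (@numField_cvg_lim C). Qed.

Lemma hasprod_unique f (l m : R[i]) : hasprod f l -> hasprod f m -> l = m.
Proof. by move=> /hasprod_lim <- /hasprod_lim. Qed.

Lemma eq_hasprod f g (l : R[i]) : f =1 g -> hasprod f l -> hasprod g l.
Proof.
by move=> fg; rewrite /hasprod; have -> : f = g by apply/funext.
Qed.

Lemma hasprod_mul f g (l m : R[i]) :
  hasprod f l -> hasprod g m -> hasprod (fun i => f i * g i) (l * m).
Proof.
move=> fl gm; rewrite /hasprod.
have -> : (fun n => \prod_(i < n) (f i * g i)) =
    (fun n => (\prod_(i < n) f i) * (\prod_(i < n) g i)).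
  by apply/funext => n; rewrite big_split.
exact: (@numField_cvgM C (fun n => \prod_(i < n) f i)
  (fun n => \prod_(i < n) g i) l m fl gm).
Qed.

(** The inverses have a convergent product too, and the two limits multiply to 1. *)
Lemma hasprod_neq0 f (l : R[i]) : near_one f -> (forall i, f i != 0) ->
  hasprod f l -> l != 0.
Proof.
move=> nf f0 fl; have [m fm] := hasprod_ex (near_one_inv nf).
have h1 : hasprod (fun i => f i * (f i)^-1) (l * m) by exact: hasprod_mul.
have h2 : hasprod (fun i => f i * (f i)^-1) 1.
  apply: (@numField_cvg_near C _ _ 1 0 _ (@numField_cvg_cst C 1)) => n _.
  by apply: big1 => i _; rewrite divff.
apply/eqP => l0; move: (hasprod_unique h1 h2); rewrite l0 mul0r => /eqP.
by rewrite eq_sym oner_eq0.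
Qed.

(** If some factor is 0, both products are eventually 0, and [0^-1 = 0] keeps the formula true. This
    lets [PhiE] hold at every [z]. *)
Lemma hasprod_inv f (l : R[i]) : near_one f -> hasprod f l ->
  hasprod (fun i => (f i)^-1) l^-1.
Proof.
move=> nf fl; have [f0|/existsNP[k /negP]] := pselect (forall i, f i != 0).
  have [m fm] := hasprod_ex (near_one_inv nf).
  have h1 : hasprod (fun i => f i * (f i)^-1) (l * m) by exact: hasprod_mul.
  have h2 : hasprod (fun i => f i * (f i)^-1) 1.
    apply: (@numField_cvg_near C _ _ 1 0 _ (@numField_cvg_cst C 1)) => n _.
    by apply: big1 => i _; rewrite divff.
  have l0 := hasprod_neq0 nf f0 fl.
  suff -> : l^-1 = m by [].
  by apply: (mulfI l0); rewrite divff// (hasprod_unique h1 h2).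
rewrite negbK => /eqP fk0.
have z g : g k = 0 -> hasprod g 0.
  move=> gk; apply: (@numField_cvg_near C _ _ 0 k.+1 _ (@numField_cvg_cst C 0)) => n kn.
  by rewrite (bigD1 (Ordinal kn)) //= gk mul0r.
rewrite (hasprod_unique fl (z f fk0)) invr0; apply: z.
by rewrite fk0 invr0.
Qed.

(** Meant for [g] obtained from [f] by inserting a factor [c]: past the insertion its partial
    products run one index ahead. *)
Lemma hasprod_shift f (g : nat -> R[i]) (c l : R[i]) (N : nat) :
  (forall n, (N <= n)%N -> \prod_(i < n.+1) g i = c * \prod_(i < n) f i) ->
  hasprod f l -> hasprod g (c * l).
Proof.
move=> h fl; have h1 := @numField_cvgM C _ _ c l (@numField_cvg_cst C c) fl.
apply: (@numField_cvg_near C _ _ _ N.+1 _ (@numField_cvg_shift C _ _ h1)).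
by case=> // n /h.
Qed.

End product_rules.

(** * Factorization of [Phi] *)

Section Phi_products.
Context {R : realType}.
Local Open Scope complex_scope.
Local Notation C := (R[i] : numFieldType).
Implicit Types (a : nat -> R) (q : parameters R).

(** The function with zeros 1/a_i; the four products in [Phi] are its values at [- z], [- z^-1], [z]
    and [z^-1] for the respective sequences. *)
Definition lin_prod a (z : R[i]) : R[i] :=
  limn (fun n => \prod_(i < n) (1 - (a i)%:C * z) : C).

Lemma near_one_lin a z : (forall i, 0 <= a i) -> bounded_sums a ->
  near_one (fun i => 1 - (a i)%:C * z).
Proof.
move=> a0 sa; apply: (@bounded_sums_le _ a _ 0 (cabs z)) => // [i||i _];
  try exact: cabs_ge0.
by rewrite addrAC subrr add0r cabsN cabsM cabs_real// mulrC.
Qed.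

Lemma hasprod_lin a z : (forall i, 0 <= a i) -> bounded_sums a ->
  hasprod (fun i => 1 - (a i)%:C * z) (lin_prod a z).
Proof.
move=> a0 sa; have [l h] := hasprod_ex (near_one_lin z a0 sa).
by rewrite /lin_prod (hasprod_lim h).
Qed.

Lemma hasprod_lin_prod a z (l : R[i]) :
  hasprod (fun i => 1 - (a i)%:C * z) l -> lin_prod a z = l.
Proof. exact: hasprod_lim. Qed.

Lemma valid_bounded_sums q : valid q ->
  [/\ (forall i, 0 <= ap q i) /\ bounded_sums (ap q),
      (forall i, 0 <= am q i) /\ bounded_sums (am q),
      (forall i, 0 <= bp q i) /\ bounded_sums (bp q) &
      (forall i, 0 <= bm q i) /\ bounded_sums (bm q)].
Proof.
move=> [[pa _] [ma _] [pb _] [mb _] sq].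
pose t i := ap q i + am q i + bp q i + bm q i.
have t0 i : 0 <= t i by rewrite !addr_ge0.
have [M tM] : bounded_sums t.
  exists (fine (\sum_(0 <= i <oo) (t i)%:E)%E) => n.
  rewrite -lee_fin fineK; last first.
    rewrite ge0_fin_numE//; apply: nneseries_ge0 => i _ _; rewrite lee_fin.
    exact: t0.
  rewrite -sumEFin -(big_mkord xpredT (fun i => (t i)%:E)).
  by apply: nneseries_lim_ge => i _ _; rewrite lee_fin.
have st a : (forall i, 0 <= a i) -> (forall i, a i <= t i) -> bounded_sums a.
  move=> a0 le_at; exists M => n; apply: le_trans (tM n).
  by apply: ler_sum => i _.
by split; split => //; apply: st => // i; rewrite /t;
  have := pa i; have := ma i; have := pb i; have := mb i; lra.
Qed.

Lemma bounded_sums_valid q :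
  decreasing_nonneg (ap q) -> decreasing_nonneg (am q) ->
  decreasing_nonneg (bp q) -> decreasing_nonneg (bm q) ->
  bounded_sums (ap q) -> bounded_sums (am q) ->
  bounded_sums (bp q) -> bounded_sums (bm q) ->
  valid q.
Proof.
move=> pa ma pb mb [A sA] [A' sA'] [B sB] [B' sB']; split=> //.
apply: (@le_lt_trans _ _ (A + A' + B + B')%:E); last exact: ltry.
apply: lime_le.
  apply: is_cvg_nneseries => i _ _; rewrite lee_fin.
  by case: pa ma pb mb => [h1 _] [h2 _] [h3 _] [h4 _]; rewrite !addr_ge0.
apply: nearW => n; rewrite sumEFin lee_fin big_mkord !big_split /=.
by have := sA n; have := sA' n; have := sB n; have := sB' n; lra.
Qed.

Lemma valid_swap q : valid q -> valid (swap_ab q).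
Proof.
move=> vq; have [[_ ?] [_ ?] [_ ?] [_ ?]] := valid_bounded_sums vq.
by case: vq => ? ? ? ? _; exact: bounded_sums_valid.
Qed.

Lemma PhiE q z : valid q -> Phi q z =
  cexp ((cp q)%:C * z + (cm q)%:C / z) *
  (lin_prod (bp q) (- z) * lin_prod (bm q) (- z^-1) /
   (lin_prod (ap q) z * lin_prod (am q) z^-1)).
Proof.
move=> /valid_bounded_sums[[pa sa] [pa' sa'] [pb sb] [pb' sb']].
have hb := @hasprod_lin _ (- z) pb sb; have hb' := @hasprod_lin _ (- z^-1) pb' sb'.
have ha := hasprod_inv (near_one_lin z pa sa) (@hasprod_lin _ z pa sa).
have ha' := hasprod_inv (near_one_lin z^-1 pa' sa') (@hasprod_lin _ z^-1 pa' sa').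
have h := hasprod_mul (hasprod_mul hb hb') (hasprod_mul ha ha').
rewrite -invfM in h.
have {}h : hasprod (fun i => (1 + (bp q i)%:C * z) * (1 + (bm q i)%:C / z) /
    ((1 - (ap q i)%:C * z) * (1 - (am q i)%:C / z)))
    (lin_prod (bp q) (- z) * lin_prod (bm q) (- z^-1) /
      (lin_prod (ap q) z * lin_prod (am q) z^-1)).
  by apply: eq_hasprod h => i; rewrite !mulrN !opprK -invfM.
by rewrite /Phi (hasprod_lim h).
Qed.

Lemma Phi_swap q z : valid q -> Phi (swap_ab q) (- z) = (Phi q z)^-1.
Proof.
move=> vq; rewrite (PhiE _ (valid_swap vq)) (PhiE _ vq) /=.
rewrite invrN !opprK !mulrN -opprD -cexpV.
move: (cexp _) (lin_prod _ _) (lin_prod _ _) (lin_prod _ _) (lin_prod _ _).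
by move=> c A A' B B'; rewrite !invfM !invrK; ring.
Qed.

Lemma Phi_translate q v z : cm q = 0 ->
  Phi (translate q v) z = cexp (v%:C * z) * Phi q z.
Proof.
move=> cm0; rewrite /Phi /= cm0 mulrA -cexpD; congr (cexp _ * _).
by rewrite rmorphD /= mulrDl; ring.
Qed.

(** Lets bounds on the vertex of [Gamma_minus] be deduced from those for [Gamma_plus]. *)
Lemma lower_bE q : lower_b q = (- lower_a (swap_ab q))%E.
Proof.
rewrite /lower_b /lower_a /= addrC; case: ifP => _; first by rewrite oppe0.
by case: ifP.
Qed.

Lemma swap_abK q : swap_ab (swap_ab q) = q.
Proof. by case: q. Qed.

Lemma lower_b_swap q : lower_b (swap_ab q) = (- lower_a q)%E.
Proof. by rewrite lower_bE swap_abK. Qed.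

Lemma lower_b_swap_lt q (y : R) :
  (lower_b (swap_ab q) < y%:E)%E -> ((- y)%:E < lower_a q)%E.
Proof. by rewrite lower_b_swap EFinN lteNl. Qed.

Lemma lower_a_swap_lt q (x : R) :
  (x%:E < lower_a (swap_ab q))%E -> (lower_b q < (- x)%:E)%E.
Proof. by rewrite lower_bE EFinN lteN2. Qed.

End Phi_products.

(** * Moving minus parameters to plus parameters *)

Section insertion.
Context {R : realType}.
Implicit Types (a : nat -> R) (x : R).

(* The decreasing rearrangement of the sequence x, a_0, a_1, ... *)
Definition insert x a (n : nat) : R :=
  if n is m.+1 then Num.max (a n) (Num.min x (a m)) else Num.max (a 0%N) x.

(** Stated for a general commutative operation, since sums are needed for summability and products
    for [lin_prod]. *)
Lemma big_insert T (idx : T) (op : Monoid.com_law idx) (F : R -> T) x a n :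
  decreasing_nonneg a ->
  \big[op/idx]_(i < n.+1) F (insert x a i) =
  if a n <= x then op (F x) (\big[op/idx]_(i < n) F (a i))
  else \big[op/idx]_(i < n.+1) F (a i).
Proof.
move=> [_ da]; elim: n => [|n IH].
  by rewrite !big_ord_recr !big_ord0 /= !Monoid.mul1m Monoid.mulm1;
    rewrite maxC; case: leP.
rewrite big_ord_recr /= IH; have [anx|xan] := leP (a n) x.
  rewrite (le_trans (da n) anx) (max_idPr (da n)) [in RHS]big_ord_recr /=.
  by rewrite Monoid.mulmA.
have [an1x|xan1] := leP (a n.+1) x; first by rewrite Monoid.mulmC.
by rewrite [in RHS]big_ord_recr.
Qed.

Lemma insert_decreasing x a : 0 <= x -> decreasing_nonneg a ->
  decreasing_nonneg (insert x a).
Proof.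
move=> x0 [a0 da]; split=> [[|i]|[|i]] /=; rewrite ?le_max ?a0 ?x0//.
  by rewrite ge_max da ge_min lexx orbT.
by rewrite ge_max da ge_min lexx orbT.
Qed.

Lemma insert_forall (Q : R -> Prop) x a :
  Q x -> (forall i, Q (a i)) -> forall i, Q (insert x a i).
Proof.
move=> Qx Qa [|i] /=; first by case: leP.
by case: (leP x (a i)) => _; case: leP.
Qed.

Lemma bounded_sums_insert x a : 0 <= x -> decreasing_nonneg a -> bounded_sums a ->
  bounded_sums (insert x a).
Proof.
move=> x0 da [M aM]; exists (x + M) => -[|n].
  by rewrite big_ord0 addr_ge0//; have := aM 0%N; rewrite big_ord0.
rewrite (big_insert _ id)//; case: ifP => _; first by rewrite lerD2l.
by rewrite -[leLHS]add0r lerD.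
Qed.

Local Open Scope complex_scope.

(** As [a] tends to 0 and [x] is positive, [x] finds its place after finitely many terms. *)
Lemma lin_prod_insert x a z : 0 < x -> decreasing_nonneg a -> bounded_sums a ->
  lin_prod (insert x a) z = (1 - x%:C * z) * lin_prod a z.
Proof.
move=> x0 da sa; have a0 := da.1.
have /cvgrPdist_lt/(_ x x0)[N _ hN] := bounded_sums_cvg0 a0 sa.
apply: hasprod_lin_prod; apply: (hasprod_shift (N := N)) (hasprod_lin a0 sa).
move=> n Nn; rewrite (big_insert _ (fun y => 1 - y%:C * z))//.
have := hN n Nn; rewrite /= sub0r normrN ger0_norm// => /ltW ->.
by [].
Qed.

Lemma insert_seq_spec (s : seq R) a : (forall x, x \in s -> 0 < x) ->
  decreasing_nonneg a -> bounded_sums a ->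
  [/\ decreasing_nonneg (foldr insert a s), bounded_sums (foldr insert a s) &
      forall z, lin_prod (foldr insert a s) z =
                (\prod_(x <- s) (1 - x%:C * z)) * lin_prod a z].
Proof.
move=> s0 da sa; elim: s s0 => [|x s IH] s0 /=.
  by split=> // z; rewrite big_nil mul1r.
have [|d1 s1 e1] := IH; first by move=> y ys; apply: s0; rewrite inE ys orbT.
have x0 : 0 < x by apply: s0; rewrite mem_head.
split; [exact: insert_decreasing (ltW x0) d1|exact: bounded_sums_insert (ltW x0) d1 s1|].
by move=> z; rewrite lin_prod_insert// e1 big_cons mulrA.
Qed.

Lemma insert_seq_forall (Q : R -> Prop) (s : seq R) a :
  (forall x, x \in s -> Q x) -> (forall i, Q (a i)) ->
  forall i, Q (foldr insert a s i).
Proof.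
move=> Qs Qa; elim: s Qs => [//|x s IH] Qs; apply: insert_forall.
  by apply: Qs; rewrite mem_head.
by apply: IH => y ys; apply: Qs; rewrite inE ys orbT.
Qed.

(** The pole 1/a moves to 1/a - D; this form of the reciprocal also makes sense for a = 0. *)
Definition moved a (D : R) (i : nat) : R := a i / (1 - a i * D).

Lemma moved_decreasing a D : decreasing_nonneg a -> (forall i, a i * D < 1) ->
  decreasing_nonneg (moved a D).
Proof.
move=> [a0 da] aD; have p i : 0 < 1 - a i * D by rewrite subr_gt0.
split=> i; rewrite /moved; first by rewrite divr_ge0// ltW.
rewrite ler_pdivrMr// mulrAC ler_pdivlMr//.
rewrite !mulrBr !mulr1 lerB//.
by rewrite mulrCA [X in _ <= X]mulrCA mulrA [leRHS]mulrA [a i * _]mulrC.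
Qed.

Lemma bounded_sums_moved a D : decreasing_nonneg a -> (forall i, a i * D < 1) ->
  bounded_sums a -> bounded_sums (moved a D).
Proof.
move=> da aD sa; have a0 := da.1; have [m0 _] := moved_decreasing da aD.
(* Below this threshold [a i * D] is at most 1/2, so that [moved a D i <= 2 * a i]. *)
have e0 : 0 < (2 * (1 + `|D|))^-1.
  by rewrite invr_gt0 mulr_gt0// ltr_wpDr.
have /cvgrPdist_lt/(_ _ e0)[N _ hN] := bounded_sums_cvg0 a0 sa.
apply: (@bounded_sums_le _ a _ N 2 _ _ _ _ sa) => // i Ni.
have := hN i Ni; rewrite /= sub0r normrN ger0_norm// => h.
have D0 : 0 < 1 + `|D| by rewrite ltr_wpDr.
have h1 : a i * (1 + `|D|) < 1 / 2.
  by move: h; rewrite invfM ltr_pdivlMr// div1r.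
have h2 : a i * D <= a i * (1 + `|D|).
  by rewrite ler_wpM2l// (le_trans (ler_norm D))// lerDr.
have p : 0 < 1 - a i * D by rewrite subr_gt0.
rewrite /moved ler_pdivrMr//.
have : 1 <= 2 * (1 - a i * D) by lra.
by move=> h3; rewrite mulrAC -{1}[a i]mul1r ler_wpM2r.
Qed.

(** Factor by factor, 1 - a_i (z - D) / (1 - a_i D) = (1 - a_i z) / (1 - a_i D). *)
Lemma lin_prod_moved a D : decreasing_nonneg a -> (forall i, a i * D < 1) ->
  bounded_sums a ->
  lin_prod a D%:C != 0 /\
  forall z, lin_prod (moved a D) (z - D%:C) = lin_prod a z / lin_prod a D%:C.
Proof.
move=> da aD sa; have a0 := da.1.
have nz i : 1 - (a i)%:C * D%:C != 0.
  have -> : 1 - (a i)%:C * D%:C = (1 - a i * D)%:C by rewrite rmorphB rmorphM.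
  by rewrite fmorph_eq0 gt_eqF// subr_gt0.
split.
  exact: hasprod_neq0 (near_one_lin D%:C a0 sa) nz (hasprod_lin a0 sa).
move=> z; apply: hasprod_lin_prod.
have h := hasprod_mul (@hasprod_lin _ _ z a0 sa)
  (hasprod_inv (near_one_lin D%:C a0 sa) (@hasprod_lin _ _ D%:C a0 sa)).
apply: eq_hasprod h => i; rewrite /moved.
rewrite fmorph_div rmorphB rmorph1 rmorphM /=.
by field; exact: nz.
Qed.

Lemma lin_prod_finite a n z : (forall i, (n <= i)%N -> a i = 0) ->
  lin_prod a z = \prod_(i < n) (1 - (a i)%:C * z).
Proof.
move=> an; apply: hasprod_lin_prod.
apply: (@numField_cvg_near (R[i] : numFieldType) _ _ _ n _
  (@numField_cvg_cst (R[i] : numFieldType) _)) => m nm.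
rewrite -[in LHS](subnKC nm) big_split_ord /= [X in _ * X]big1 ?mulr1//.
by move=> i _; rewrite an ?leq_addr// mul0r subr0.
Qed.

End insertion.

(** * Positive parameters with the same [Phi] up to a shift and a constant *)

Section positive_parameters.
Context {R : realType}.
Local Open Scope complex_scope.
Implicit Types (a m : nat -> R) (D : R) (n k : nat).

(* A factor with pole rho = 1/a_i, m_i or 0 becomes, after the time shift by D,
   one with pole rho - D > 0, that is with positive parameter 1/(rho - D). *)
Definition plus_seq D a m n k : nat -> R :=
  foldr insert (moved a D)
    ([seq (m i - D)^-1 | i <- iota 0 n] ++ nseq k (0 - D)^-1).

(** All poles 1/a_i, m_i for i < n, and 0 if present, lie to the right of [D]; the product form of
    the first condition includes a_i = 0. *)
Definition movable D a m n k : Prop :=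
  [/\ (forall i, a i * D < 1), (forall i, (i < n)%N -> D < m i) &
      (0 < k)%N -> D < 0].

Lemma plus_seq_terms D a m n k x : movable D a m n k ->
  x \in [seq (m i - D)^-1 | i <- iota 0 n] ++ nseq k (0 - D)^-1 ->
  exists rho, [/\ x = (rho - D)^-1, D < rho &
    (rho = 0 /\ (0 < k)%N) \/ exists2 i, (i < n)%N & rho = m i].
Proof.
move=> [_ Dm Dk]; rewrite mem_cat => /orP[/mapP h|].
  case: h => i.
  rewrite mem_iota /= add0n => ni ->; exists (m i); split; [by []|exact: Dm|].
  by right; exists i.
by rewrite mem_nseq => /andP[k0 /eqP ->]; exists 0; split; auto.
Qed.

(** A pole rho gives the factor (rho - z) / (rho - D). Since m_i - z = (- z) (1 - m_i / z), the
    minus factors reappear at the price of [n] powers of [- z]; the [k] poles at 0 give the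
    others. *)
Lemma plus_seq_spec D a m n k : movable D a m n k ->
  decreasing_nonneg a -> bounded_sums a -> (forall i, (n <= i)%N -> m i = 0) ->
  [/\ decreasing_nonneg (plus_seq D a m n k), bounded_sums (plus_seq D a m n k) &
      exists2 c : R[i], c != 0 & forall z, (z != 0) || (n + k == 0)%N ->
        lin_prod (plus_seq D a m n k) (z - D%:C) =
        c * (- z) ^+ (n + k) * (lin_prod a z * lin_prod m z^-1)].
Proof.
move=> mv da sa mn; have [aD Dm Dk] := mv.
have [|d1 s1 e1] := @insert_seq_spec _ ([seq (m i - D)^-1 | i <- iota 0 n] ++
    nseq k (0 - D)^-1) _ _ (moved_decreasing da aD) (bounded_sums_moved da aD sa).
  by move=> x /(plus_seq_terms mv)[rho [-> Drho _]]; rewrite invr_gt0 subr_gt0.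
split=> //; have [l0 lE] := lin_prod_moved da aD sa.
exists ((\prod_(i < n) (m i - D)%:C^-1) * (0 - D)%:C^-1 ^+ k / lin_prod a D%:C).
  rewrite mulf_neq0 ?invr_neq0// mulf_neq0//.
    apply/prodf_neq0 => i _; rewrite invr_neq0// fmorph_eq0 gt_eqF// subr_gt0.
    exact: Dm.
  case: k Dk {mv d1 s1 e1} => [|k] Dk; first by rewrite expr0 oner_eq0.
  by rewrite expf_neq0// invr_neq0// fmorph_eq0 gt_eqF// subr_gt0 Dk.
have term (rho : R) z : D < rho -> 1 - ((rho - D)^-1)%:C * (z - D%:C) =
    (rho - D)%:C^-1 * (rho%:C - z).
  move=> Drho; have h : (rho - D)%:C != 0 by rewrite fmorph_eq0 gt_eqF// subr_gt0.
  by move: h; rewrite fmorphV rmorphB /= => h; field.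
move=> z hz; rewrite e1 lE big_cat big_map big_nseq /= iter_mulr_1.
rewrite (lin_prod_finite _ mn).
have -> : \prod_(i <- iota 0 n) (1 - (m i - D)^-1%:C * (z - D%:C)) =
    (\prod_(i < n) (m i - D)%:C^-1) * (- z) ^+ n *
    \prod_(i < n) (1 - (m i)%:C * z^-1).
  have -> : iota 0 n = index_iota 0 n by rewrite /index_iota subn0.
  rewrite big_mkord -[X in (- z) ^+ X](card_ord n) -prodr_const -!big_split /=.
  apply: eq_bigr => i _; rewrite term ?Dm// -mulrA; congr (_ * _).
  have z0 : z != 0.
    case/orP: hz => //; rewrite addn_eq0 => /andP[/eqP n0 _].
    by case: i => i; rewrite n0.
  by field.
have -> : (1 - (0 - D)^-1%:C * (z - D%:C)) ^+ k = (0 - D)%:C^-1 ^+ k * (- z) ^+ k.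
  case: k Dk {mv d1 s1 e1 hz} => [|k] Dk; first by rewrite !expr0 mulr1.
  by rewrite term ?Dk// rmorph0 !sub0r exprMn.
by rewrite exprD; ring.
Qed.

(** For a term 1 / (rho - D) the claim says x < rho, which for rho = 0 or rho = m_i follows from x <
    0. It keeps admissible vertices admissible. *)
Lemma plus_seq_lt D a m n k (x : R) : movable D a m n k ->
  (forall i, 0 <= m i) -> (forall i, x * a i < 1) -> ((0 < n + k)%N -> x < 0) ->
  forall i, (x - D) * plus_seq D a m n k i < 1.
Proof.
move=> mv m0 xa xneg; have [aD _ _] := mv.
apply: (@insert_seq_forall _ (fun y => (x - D) * y < 1)) =>
    [y /(plus_seq_terms mv)[rho [-> Drho h]]|i].
  rewrite ltr_pdivrMr ?subr_gt0// mul1r ltrD2r.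
  case: h => [[-> k0]|[i ni ->]].
    by apply: xneg; rewrite addn_gt0 k0 orbT.
  apply: lt_le_trans (m0 i); apply: xneg.
  by rewrite addn_gt0 (leq_ltn_trans _ ni).
rewrite /moved mulrA ltr_pdivrMr ?subr_gt0// mul1r mulrBl.
by have := xa i; rewrite [D * _]mulrC; lra.
Qed.

(** With [n] and [m] positive minus terms, [Phi] behaves at 0 like a multiple of z^(n - m): a pole
    if [n < m], a zero if [m < n], and truncated subtraction selects the case. Zeros become poles
    under z -> -z, hence [- D]. *)
Definition plus_params (q : parameters R) (n m : nat) D : parameters R :=
  MkParams (plus_seq D (ap q) (am q) n (m - n)) (cst 0)
           (plus_seq (- D) (bp q) (bm q) m (n - m)) (cst 0) 0 0.

Lemma swap_plus_params (q : parameters R) (n m : nat) D :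
  swap_ab (plus_params q n m D) = plus_params (swap_ab q) m n (- D).
Proof. by rewrite /swap_ab /plus_params /= opprK. Qed.

Lemma zero_decreasing : decreasing_nonneg (cst (0 : R)).
Proof. by split. Qed.

Lemma zero_bounded_sums : bounded_sums (cst (0 : R)).
Proof. by exists 0 => n; rewrite big1. Qed.

Lemma lin_prod0 (z : R[i]) : lin_prod (cst 0) z = 1.
Proof. by rewrite (@lin_prod_finite _ _ 0) ?big_ord0. Qed.

Lemma J_zero : J (cst (0 : R)) = 0%E.
Proof.
apply/eqP; rewrite eq_le; apply/andP; split.
  by apply: ereal_inf_lbound; exists 0%N.
by apply: le_ereal_inf_tmp => _ [k _ <-]; rewrite lee_fin.
Qed.

Section move_to_plus.
Variables (q : parameters R) (n m : nat) (D : R).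
Hypothesis vq : valid q.
Hypotheses (amn : forall i, (n <= i)%N -> am q i = 0)
  (bmm : forall i, (m <= i)%N -> bm q i = 0).
Hypotheses (mvA : movable D (ap q) (am q) n (m - n))
  (mvB : movable (- D) (bp q) (bm q) m (n - m)).

Lemma plus_params_Ppos : Ppos (plus_params q n m D).
Proof.
have [[_ sa] _ [_ sb] _] := valid_bounded_sums vq; have [da _ db _ _] := vq.
have [d1 s1 _] := plus_seq_spec mvA da sa amn.
have [d2 s2 _] := plus_seq_spec mvB db sb bmm.
split=> //=; rewrite ?J_zero//; split=> //=; last by rewrite !J_zero adde0 ltry.
by apply: bounded_sums_valid => //=; first [exact: zero_decreasing|exact: zero_bounded_sums].
Qed.

(** Both plus products carry the power [maxn n m] of [z] up to sign, so these powers cancel and only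
    constants remain. *)
Lemma Phi_plus_params : exists2 k : R[i], k != 0 &
  forall z, (z != 0) || (n + m == 0)%N ->
  Phi (translate q (- cp q)) z = k * Phi (plus_params q n m D) (z - D%:C).
Proof.
have [[_ sa] _ [_ sb] _] := valid_bounded_sums vq; have [da _ db _ _] := vq.
have [_ _ [c c0 cE]] := plus_seq_spec mvA da sa amn.
have [_ _ [c' c'0 c'E]] := plus_seq_spec mvB db sb bmm.
have mx : (n + (m - n) = m + (n - m))%N by rewrite -!maxnE maxnC.
exists (c / c' * (- 1) ^+ (n + (m - n))).
  by rewrite !mulf_neq0 ?invr_neq0// signr_eq0.
move=> z hz; have vq' : valid (translate q (- cp q)) by case: vq.
have [[vp _ _] _ _ _] := plus_params_Ppos.
rewrite (PhiE _ vq') (PhiE _ vp) /= !lin_prod0 subrr !mul0r !addr0 cexp0 !mulr1 !mul1r.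
have hz1 : (z != 0) || (n + (m - n) == 0)%N.
  by case/orP: hz => [->//|/eqP h]; apply/orP; right; rewrite -maxnE; lia.
have hz2 : (- z != 0) || (m + (n - m) == 0)%N by rewrite oppr_eq0 -mx.
rewrite (cE z hz1).
have -> : - (z - D%:C) = - z - (- D)%:C by rewrite rmorphN opprB opprK addrC.
rewrite (c'E _ hz2) opprK -mx invrN.
have zN : z ^+ (n + (m - n)) != 0.
  by case/orP: hz1 => [z0|/eqP ->]; [rewrite expf_neq0|rewrite expr0 oner_eq0].
rewrite [(- z) ^+ _]exprNn.
set N := (n + (m - n))%N in zN *; set s := (-1) ^+ N.
have ss : s * s^-1 = 1 by rewrite divff// signr_eq0.
have zz : z ^+ N * (z ^+ N)^-1 = 1 by rewrite divff.
have cc : c * c^-1 = 1 by rewrite divff.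
have cc' : c'^-1 * c' = 1 by rewrite mulVf.
move: (lin_prod (bp q) _) (lin_prod (bm q) _) (lin_prod (ap q) _)
  (lin_prod (am q) _) => B B' A A'.
rewrite !invfM.
transitivity ((c * c^-1) * (c'^-1 * c') * (s * s^-1) * (z ^+ N * (z ^+ N)^-1) *
  (B * B' * (A^-1 * A'^-1))); first by rewrite cc cc' ss zz; ring.
by ring.
Qed.

(** Admissibility in multiplicative form: the vertex is left of every 1/a_i, and left of 0 once some
    minus parameter is present. *)
Lemma lower_a_cases (x : R) : cm q = 0 -> (x%:E < lower_a q)%E ->
  (forall i, (i < n)%N -> 0 < am q i) -> (forall i, (i < m)%N -> 0 < bm q i) ->
  (forall i, x * ap q i < 1) /\ ((0 < n + m)%N -> x < 0).
Proof.
move=> cm0 + an bn; have [[pa da] [ma _] [pb _] [mb _] _] := vq.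
have ap0 i : ap q i <= ap q 0%N.
  by elim: i => // i; apply: le_trans.
rewrite /lower_a cm0 eqxx orbF.
have [h|h] := ltP 0 (am q 0%N + bm q 0%N); rewrite ?lte_fin => hx.
  split=> [i|//]; apply: (@le_lt_trans _ _ 0) => //.
  by rewrite mulr_le0_ge0// ltW.
have nm0 : (0 < n + m)%N = false.
  apply/negbTE; rewrite -leqNgt leqn0 addn_eq0; apply/andP.
  split; rewrite -leqn0 leqNgt;
    apply/negP => l0.
    by have := an 0%N l0; have := mb 0%N; lra.
  by have := bn 0%N l0; have := ma 0%N; lra.
rewrite nm0; split=> // i; have [x0|x0] := leP x 0.
  by apply: (@le_lt_trans _ _ 0) => //; rewrite mulr_le0_ge0.
apply: le_lt_trans (_ : x * ap q 0%N < 1); first by rewrite ler_wpM2l// ltW.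
move: hx; have [a0|a0 _] := ltP 0 (ap q 0%N); last first.
  by apply: (@le_lt_trans _ _ 0) => //; rewrite mulr_ge0_le0// ltW.
by rewrite lte_fin -[_^-1]mul1r ltr_pdivlMr.
Qed.

Lemma lower_a_plus_params (x : R) : cm q = 0 -> (x%:E < lower_a q)%E ->
  (forall i, (i < n)%N -> 0 < am q i) -> (forall i, (i < m)%N -> 0 < bm q i) ->
  ((x - D)%:E < lower_a (plus_params q n m D))%E.
Proof.
move=> cm0 hx an bn; have [xa xneg] := lower_a_cases cm0 hx an bn.
have [_ [ma _] _ _ _] := vq.
have h := plus_seq_lt mvA ma xa.
rewrite /lower_a /= addr0 ltxx eqxx /=;
have [a0|_] := ltP 0 (plus_seq D (ap q) (am q) n (m - n) 0%N); last exact: ltry.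
rewrite lte_fin -[_^-1]mul1r ltr_pdivlMr//; apply: h => h; apply: xneg; lia.
Qed.

End move_to_plus.

End positive_parameters.

(** * Symmetries of the wanderer ensembles *)

Section kernel_determinants.
Context {R : realType}.
Local Open Scope complex_scope.
Implicit Types (K : R * R -> R * R -> R[i]) (phi : R * R -> R * R).

Lemma kernel_det_map K phi xs : kernel_det K (map phi xs) =
  \det (\matrix_(i < size xs, j < size xs) K (phi xs`_i) (phi xs`_j)).
Proof.
(* The dimensions [size xs] and [size (map phi xs)] are equal but not convertible; an abstract [n]
   links them. *)
rewrite /kernel_det; have [n sn] : exists n, n = size xs by exists (size xs).
have sm : n = size (map phi xs) by rewrite size_map.
have -> : \det (\matrix_(i < size xs, j < size xs) K (phi xs`_i) (phi xs`_j)) =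
    \det (\matrix_(i < n, j < n) K (map phi xs)`_i (map phi xs)`_j).
  rewrite sn; congr determinant; apply/matrixP => i j.
  by rewrite !mxE !(nth_map 0).
by rewrite sm.
Qed.

Lemma kernel_det_gauge K K' phi (g : R * R -> R[i]) xs :
  (forall p, g p != 0) ->
  (forall p p', K' p p' = g p * K (phi p) (phi p') / g p') ->
  kernel_det K' xs = kernel_det K (map phi xs).
Proof.
move=> g0 KE; rewrite kernel_det_map /kernel_det.
set M := (X in _ = \det X).
have -> : (\matrix_(i < size xs, j < size xs) K' xs`_i xs`_j) =
    diag_mx (\row_i g xs`_i) *m M *m diag_mx (\row_j (g xs`_j)^-1).
  apply/matrixP => i j; rewrite mul_mx_diag mul_diag_mx !mxE.
  exact: KE.
rewrite !det_mulmx !det_diag mulrAC -big_split /= big1 ?mul1r// => i _.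
by rewrite !mxE divff.
Qed.

Lemma kernel_det_tr K K' phi xs :
  (forall p p', K' p p' = K (phi p') (phi p)) ->
  kernel_det K' xs = kernel_det K (map phi xs).
Proof.
move=> KE; rewrite kernel_det_map /kernel_det -det_tr; congr determinant.
by apply/matrixP => i j; rewrite !mxE.
Qed.

End kernel_determinants.

Section wanderer_symmetries.
Context {R : realType}.
Local Open Scope complex_scope.
Variables (d : measure_display) (Omega : measurableType d)
  (P : probability Omega R).
Implicit Types (q : parameters R) (A : Omega -> curves R).

Let sqrt2_neq0 : Num.sqrt 2 != 0 :> R.
Proof. by rewrite sqrtr_eq0 -ltNge. Qed.

Lemma wanderer_translate q v A : cm q = 0 -> is_airy_wanderer q P A ->
  is_airy_wanderer (translate q v) P (fun w => add_const v (A w)).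
Proof.
move=> cm0 [mA [K [wK detK]] gA]; split.
- exact: measurableT_comp (measurable_add_const v) mA.
- exists (fun t1 x1 t2 x2 =>
    (expR (v * (t1 - t2)))%:C * K t1 (x1 - v) t2 (x2 - v)); split.
    move=> t1 x1 t2 x2 alpha beta.
    have -> : lower_a (translate q v) = lower_a q by rewrite /lower_a /= cm0.
    have -> : lower_b (translate q v) = lower_b q by rewrite /lower_b /= cm0.
    move=> ha hb.
    rewrite (wK _ _ _ _ alpha beta)//.
    rewrite (K1_translate v alpha beta t1 x1) (K2_translate v t1 x1).
    rewrite (K3_translate _ _ _ _ _ _ (fun z => Phi_translate v z cm0)).
    by rewrite rmorphM /=; ring.
  move=> s s0 ss; have [mRe mIm _] := detK s s0 ss.
  pose phi (p : R * R) : R * R := (p.1, p.2 - v).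
  have mphi : measurable_fun setT (fun pq : (R * R) * (R * R) => (phi pq.1, phi pq.2)).
    apply: measurable_fun_pair; apply: measurable_fun_pair.
    - exact: measurableT_comp.
    - by apply: measurable_funB => //; exact: measurableT_comp.
    - exact: measurableT_comp.
    - by apply: measurable_funB => //; exact: measurableT_comp.
  have me : measurable_fun setT
      (fun pq : (R * R) * (R * R) => expR (v * (pq.1.1 - pq.2.1))).
    apply: measurableT_comp => //; apply: measurable_funM => //.
    by apply: measurable_funB; exact: measurableT_comp.
  have ReM (k : R) (z : R[i]) : complex.Re (k%:C * z) = k * complex.Re z.
    by case: z => a b /=; ring.
  have ImM (k : R) (z : R[i]) : complex.Im (k%:C * z) = k * complex.Im z.
    by case: z => a b /=; ring.
  apply: (@determinantal_transfer _ id id v 0 _ _ _ _ _ _ _ _ A _ s s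
    (fun p p' => K p.1 p.2 p'.1 p'.2)); rewrite ?map_id//.
  + by move=> t; rewrite addr0.
  + under eq_fun do rewrite ReM; apply: measurable_funM => //.
    exact: (measurableT_comp mRe mphi).
  + under eq_fun do rewrite ImM; apply: measurable_funM => //.
    exact: (measurableT_comp mIm mphi).
  + move=> xs; apply: (@kernel_det_gauge _ _ _ _ (fun p => (expR (v * p.1))%:C)).
      by move=> p; rewrite fmorph_eq0 gt_eqF// expR_gt0.
    move=> p p' /=; rewrite -fmorphV /= -expRN mulrAC -rmorphM /= -expRD.
    by congr ((expR _)%:C * _); ring.
  + exact: detK.
(* The Gibbs property concerns (A - t^2) / sqrt 2, which the translation raises by v / sqrt 2. *)
- have := gibbs_affine 0 (v / Num.sqrt 2) 0 gA.
  congr (brownian_gibbs _ _); apply/funext => w; apply/funext => -[i t] /=.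
  rewrite subr0; transitivity ((A w (i, t) + v - t ^+ 2) / Num.sqrt 2); last by [].
  by field.
Qed.

Lemma wanderer_swap q A : valid q -> is_airy_wanderer q P A ->
  is_airy_wanderer (swap_ab q) P (fun w => reflect_time (A w)).
Proof.
move=> vq [mA [K [wK detK]] gA]; split.
- exact: measurableT_comp measurable_reflect_time mA.
- exists (fun t1 x1 t2 x2 => K (- t2) x2 (- t1) x1); split.
    move=> t1 x1 t2 x2 alpha beta ha hb.
    (* The kernel of [q] at times [- t2] and [- t1] is expanded with vertices [- beta] and
       [- alpha]. *)
    have ha' : ((- beta - t2)%:E < lower_a q)%E.
      have -> : - beta - t2 = - (beta + t2) by rewrite opprD.
      exact: lower_b_swap_lt hb.
    have hb' : (lower_b q < (- alpha - t1)%:E)%E.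
      have -> : - alpha - t1 = - (alpha + t1) by rewrite opprD.
      exact: lower_a_swap_lt ha.
    rewrite (wK _ _ _ _ _ _ ha' hb').
    rewrite K1_swap K2_swap (@K3_swap _ q (swap_ab q))// => z.
    exact: Phi_swap.
  move=> s s0 ss; pose s' := rev (map -%R s).
  have s'0 : (0 < size s')%N by rewrite size_rev size_map.
  have ss' : sorted <%R s'.
    rewrite rev_sorted sorted_map; apply: sub_sorted ss => a b /=.
    by rewrite ltrN2.
  have [mRe mIm _] := detK s' s'0 ss'.
  pose phi (p : R * R) : R * R := (- p.1, p.2).
  have mphi : measurable_fun setT (fun pq : (R * R) * (R * R) => (phi pq.2, phi pq.1)).
    have mo : measurable_fun setT (-%R : R -> R) by exact: oppr_measurable.
    apply: measurable_fun_pair; apply: measurable_fun_pair.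
    - by apply: measurableT_comp => //; exact: measurableT_comp.
    - exact: measurableT_comp.
    - by apply: measurableT_comp => //; exact: measurableT_comp.
    - exact: measurableT_comp.
  apply: (@determinantal_transfer _ -%R -%R 0 0 _ _ _ _ _ _ _ _ A _ s s'
    (fun p p' => K p.1 p.2 p'.1 p'.2)) => //.
  + exact: opprK.
  + exact: opprK.
  + by move=> t; rewrite normrN addr0.
  + by rewrite perm_rev.
  + by move=> w i t; rewrite addr0.
  + exact: (measurableT_comp mRe mphi).
  + exact: (measurableT_comp mIm mphi).
  + by move=> xs; apply: kernel_det_tr => p p' /=; rewrite !subr0.
  + exact: detK.
- have := gibbs_reverse gA.
  congr (brownian_gibbs _ _); apply/funext => w; apply/funext => -[i t] /=.
  by rewrite sqrrN.
Qed.

(** [A] belongs to [q'] and its delay to [q]. The relation between [Phi q] and [Phi q'] is required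
    only along admissible contours, since it may fail at 0. *)
Lemma wanderer_delay q q' D (k : R[i]) A : k != 0 ->
  (forall x, (x%:E < lower_a q)%E -> ((x - D)%:E < lower_a q')%E) ->
  (forall x, (lower_b q < x%:E)%E -> (lower_b q' < (x - D)%:E)%E) ->
  (forall x u, (x%:E < lower_a q)%E ->
    Phi q (Gamma_plus x u) = k * Phi q' (Gamma_plus x u - D%:C)) ->
  (forall x u, (lower_b q < x%:E)%E ->
    Phi q (Gamma_minus x u) = k * Phi q' (Gamma_minus x u - D%:C)) ->
  is_airy_wanderer q' P A ->
  is_airy_wanderer q P (fun w => delay D (A w)).
Proof.
move=> k0 la lb Pp Pm [mA [K [wK detK]] gA]; split.
- exact: measurableT_comp (measurable_delay D) mA.
- exists (fun t1 x1 t2 x2 => K (t1 - D) x1 (t2 - D) x2); split.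
    move=> t1 x1 t2 x2 alpha beta ha hb.
    have ha' : ((alpha + (t1 - D))%:E < lower_a q')%E.
      by rewrite (addrA alpha); exact: la.
    have hb' : (lower_b q' < (beta + (t2 - D))%:E)%E.
      by rewrite (addrA beta); exact: lb.
    rewrite (wK _ _ _ _ _ _ ha' hb') K1_shift K2_shift.
    by rewrite -(K3_shift _ _ k0 (fun u => Pp _ u ha) (fun u => Pm _ u hb)).
  move=> s s0 ss; pose s' := map (fun t => t - D) s.
  have s'0 : (0 < size s')%N by rewrite size_map.
  have ss' : sorted <%R s'.
    rewrite sorted_map; apply: sub_sorted ss => a b /=.
    by rewrite ltrD2r.
  have [mRe mIm _] := detK s' s'0 ss'.
  pose phi (p : R * R) : R * R := (p.1 - D, p.2).
  have mphi : measurable_fun setT (fun pq : (R * R) * (R * R) => (phi pq.1, phi pq.2)).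
    apply: measurable_fun_pair; apply: measurable_fun_pair.
    - by apply: measurable_funB => //; exact: measurableT_comp.
    - exact: measurableT_comp.
    - by apply: measurable_funB => //; exact: measurableT_comp.
    - exact: measurableT_comp.
  apply: (@determinantal_transfer _ (fun t => t - D) (fun t => t + D) 0 `|D|
    _ _ _ _ _ _ _ _ A _ s s' (fun p p' => K p.1 p.2 p'.1 p'.2)) => //.
  + exact: subrK.
  + exact: addrK.
  + exact: measurable_funB.
  + exact: measurable_funD.
  + by move=> t; exact: ler_normB.
  + by move=> w i t; rewrite addr0.
  + exact: (measurableT_comp mRe mphi).
  + exact: (measurableT_comp mIm mphi).
  + move=> xs; apply: (@kernel_det_gauge _ _ _ _ (fun=> 1)).
      by move=> p; exact: oner_neq0.
    by move=> p p' /=; rewrite !subr0 mul1r divr1.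
  + exact: detK.
(* Delaying A but not the parabola leaves ((t - D)^2 - t^2) / sqrt 2 = (- 2 D t + D^2) / sqrt 2, an
   affine drift. *)
- have := gibbs_affine (- (2 * D) / Num.sqrt 2) (D ^+ 2 / Num.sqrt 2) D gA.
  congr (brownian_gibbs _ _); apply/funext => w; apply/funext => -[i t] /=.
  transitivity ((A w (i, t - D) - t ^+ 2) / Num.sqrt 2); last by [].
  by field.
Qed.

End wanderer_symmetries.

(** * Choice of the delay *)

Section finite_minus_parameters.
Context {R : realType}.
Local Open Scope complex_scope.
Implicit Types (a : nat -> R) (q : parameters R).

Lemma J_ge0 a : (0 <= J a)%E.
Proof. by apply: le_ereal_inf_tmp => _ [k _ <-]; rewrite lee_fin. Qed.

Lemma J_lty a : decreasing_nonneg a -> (J a < +oo)%E ->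
  exists n, (forall i, (n <= i)%N -> a i = 0) /\ (forall i, (i < n)%N -> 0 < a i).
Proof.
move=> [a0 da] Ja; have exn : exists k, a k == 0.
  apply: contrapT => h; move: Ja; rewrite /J (_ : [set k | a k = 0] = set0).
    by rewrite image_set0 ereal_inf0 ltxx.
  by apply/seteqP; split=> // k /= ak; apply: h; exists k; apply/eqP.
have [n /eqP an nmin] := ex_minnP exn; exists n; split=> i ni.
  rewrite -(subnKC ni); elim: (i - n)%N => [|j IH]; first by rewrite addn0.
  by apply/eqP; rewrite eq_le a0 andbT -IH addnS da.
rewrite lt_neqAle a0 andbT eq_sym; apply/negP => /nmin.
by rewrite leqNgt ni.
Qed.

Lemma Pfin_finite q : Pfin q -> exists n m,
  [/\ forall i, (n <= i)%N -> am q i = 0, forall i, (i < n)%N -> 0 < am q i,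
      forall i, (m <= i)%N -> bm q i = 0 & forall i, (i < m)%N -> 0 < bm q i].
Proof.
move=> [[_ da _ db _] _ Jab].
have Ja : (J (am q) < +oo)%E.
  by apply: le_lt_trans Jab; rewrite leeDl// J_ge0.
have Jb : (J (bm q) < +oo)%E.
  by apply: le_lt_trans Jab; rewrite leeDr// J_ge0.
have [n [n1 n2]] := J_lty da Ja; have [m [m1 m2]] := J_lty db Jb.
by exists n, m.
Qed.

Lemma Pfin_translate q v : Pfin q -> Pfin (translate q v).
Proof. by case. Qed.

Lemma Pfin_swap q : Pfin q -> Pfin (swap_ab q).
Proof. by case=> vq cm0 Jq; split=> //; [exact: valid_swap|rewrite addeC]. Qed.

Lemma translateK q : cm q = 0 -> translate (translate q (- cp q)) (cp q) = q.
Proof. by case: q => a a' b b' c c' /= ->; rewrite /translate /= subrr add0r. Qed.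

(** The last of the [n] terms is the smallest; if there is none, the bound 1 is a placeholder. *)
Lemma small_lt_seq (eps : R) a n : decreasing_nonneg a ->
  0 < eps -> (eps < if n is n'.+1 then a n' else 1) ->
  forall i, (i < n)%N -> eps < a i.
Proof.
move=> [_ da] e0; case: n => [//|n] h i; rewrite ltnS => ni.
apply: lt_le_trans h _; rewrite -(subnKC ni).
by elim: (n - i)%N => [|j IH]; rewrite ?addn0// addnS; apply: le_trans IH.
Qed.

Lemma movable_exists q n m : valid q ->
  (forall i, (i < n)%N -> 0 < am q i) -> (forall i, (i < m)%N -> 0 < bm q i) ->
  exists D, movable D (ap q) (am q) n (m - n) /\
    movable (- D) (bp q) (bm q) m (n - m).
Proof.
move=> [da da' db db' _] an bm0.
have e10 : 0 < if n is n'.+1 then am q n' else 1.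
  by case: n an => // n; apply.
have e20 : 0 < if m is m'.+1 then bm q m' else 1.
  by case: m bm0 => // m; apply.
set e1 := (e in 0 < e) in e10; set e2 := (e in 0 < e) in e20.
have s0 : 0 < 1 + ap q 0%N + bp q 0%N.
  by have := da.1 0%N; have := db.1 0%N; lra.
(* [eps] lies below every positive minus parameter and below every 1/a_i^+ and 1/b_i^+; the summand
   1 keeps the denominator positive. *)
pose eps := Num.min (Num.min e1 e2) (1 + ap q 0%N + bp q 0%N)^-1 / 2.
have mpos : 0 < Num.min (Num.min e1 e2) (1 + ap q 0%N + bp q 0%N)^-1.
  by rewrite !lt_min e10 e20 invr_gt0.
have eps0 : 0 < eps by rewrite divr_gt0.
have epslt : eps < Num.min (Num.min e1 e2) (1 + ap q 0%N + bp q 0%N)^-1.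
  by rewrite /eps; lra.
move: (epslt); rewrite !lt_min => /andP[/andP[lt1 lt2] lt3].
have lea := small_lt_seq da' eps0 lt1; have leb := small_lt_seq db' eps0 lt2.
have hs : eps * (1 + ap q 0%N + bp q 0%N) < 1.
  by rewrite -ltr_pdivlMr// mul1r.
have mono a : decreasing_nonneg a -> forall i, a i <= a 0%N.
  by move=> [_ dec] i; elim: i => // i; apply: le_trans.
have small (D : R) a : decreasing_nonneg a -> a 0%N <= 1 + ap q 0%N + bp q 0%N ->
    D <= eps -> forall i, a i * D < 1.
  move=> dec a0le De i; apply: le_lt_trans hs.
  apply: (@le_trans _ _ (a i * eps)); first by rewrite ler_wpM2l// dec.1.
  rewrite mulrC ler_wpM2l ?(ltW eps0)//.
  exact: le_trans (mono _ dec i) a0le.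
have ha0 : ap q 0%N <= 1 + ap q 0%N + bp q 0%N by have := db.1 0%N; lra.
have hb0 : bp q 0%N <= 1 + ap q 0%N + bp q 0%N by have := da.1 0%N; lra.
have build (D : R) : `|D| <= eps -> ((n < m)%N -> D < 0) -> ((m < n)%N -> 0 < D) ->
    movable D (ap q) (am q) n (m - n) /\ movable (- D) (bp q) (bm q) m (n - m).
  rewrite ler_norml => /andP[D1 D2] h1 h2; split; split.
  - exact: small.
  - by move=> i /lea; lra.
  - by rewrite subn_gt0.
  - by apply: small => //; lra.
  - by move=> i /leb; lra.
  - by rewrite subn_gt0 oppr_lt0.
(* A pole at 0 requires D < 0 and a zero at 0 requires D > 0; with neither, D = 0 already
   separates. *)
have [nm|mn|nm] := ltngtP n m.
- by exists (- eps); apply: build => [|_|];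
    rewrite ?normrN ?gtr0_norm ?oppr_lt0// ltnNge (ltnW nm).
- by exists eps; apply: build => [||_];
    rewrite ?gtr0_norm// ltnNge (ltnW mn).
- by exists 0; apply: build; rewrite ?normr0 ?(ltW eps0)// nm ltnn.
Qed.

Lemma Gamma_plus_neq0 (x u : R) : x != 0 -> Gamma_plus x u != 0.
Proof.
move=> x0; rewrite Gamma_plusE eq_complex /= negb_and.
have [->|u0] := eqVneq u 0; first by rewrite normr0 mul0r addr0 x0.
by rewrite [X in _ || X]mulf_neq0 ?orbT// gt_eqF// h45_gt0.
Qed.

Lemma Gamma_minus_neq0 (x u : R) : x != 0 -> Gamma_minus x u != 0.
Proof. by move=> x0; rewrite -oppr_eq0 -Gamma_plusN Gamma_plus_neq0// oppr_eq0. Qed.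

(** If minus parameters are present, admissible vertices are negative for [Gamma_plus] and positive
    for [Gamma_minus], so both contours miss 0 and [Phi_plus_params] applies; without them it holds
    at every [z]. *)
Lemma wanderer_delay_plus_params q n m D d (Omega : measurableType d)
    (P : probability Omega R) (A : Omega -> curves R) :
  valid q -> cm q = 0 ->
  (forall i, (n <= i)%N -> am q i = 0) -> (forall i, (i < n)%N -> 0 < am q i) ->
  (forall i, (m <= i)%N -> bm q i = 0) -> (forall i, (i < m)%N -> 0 < bm q i) ->
  movable D (ap q) (am q) n (m - n) -> movable (- D) (bp q) (bm q) m (n - m) ->
  is_airy_wanderer (plus_params q n m D) P A ->
  is_airy_wanderer (translate q (- cp q)) P (fun w => delay D (A w)).
Proof.
move=> vq cm0 amn an bmm bn mvA mvB hA.
have [k k0 PhiE] := Phi_plus_params vq amn bmm mvA mvB.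
have la0 : lower_a (translate q (- cp q)) = lower_a q by rewrite /lower_a /= cm0.
have lb0 : lower_b (translate q (- cp q)) = lower_b q by rewrite /lower_b /= cm0.
have lbP x : (lower_b q < x%:E)%E -> ((- x)%:E < lower_a (swap_ab q))%E.
  by rewrite lower_bE EFinN lteNl.
apply: (wanderer_delay k0 _ _ _ _ hA).
- by move=> x; rewrite la0 => hx; exact: lower_a_plus_params.
(* The condition on zeros is the one on poles for the swapped parameters and [- D]. *)
- move=> x; rewrite lb0 => /lbP hx.
  have := @lower_a_plus_params _ (swap_ab q) m n (- D) (valid_swap vq) mvB (- x)
    cm0 hx bn an.
  rewrite -swap_plus_params => /lower_a_swap_lt.
  by have -> : - (- x - - D) = x - D by ring.
- move=> x u; rewrite la0 => hx; apply: PhiE.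
  have [_ xneg] := lower_a_cases vq cm0 hx an bn.
  have [_|/xneg x0] := posnP (n + m)%N; first by rewrite orbT.
  by rewrite Gamma_plus_neq0// lt_eqF.
- move=> x u; rewrite lb0 => /lbP hx; apply: PhiE.
  have [_ xneg] := lower_a_cases (valid_swap vq) cm0 hx bn an.
  rewrite addnC; have [_|/xneg x0] := posnP (m + n)%N; first by rewrite orbT.
  by rewrite Gamma_minus_neq0// gt_eqF// -oppr_lt0.
Qed.

End finite_minus_parameters.

Theorem proposition1p10 (R : realType)
    (well_defined : airy_wanderers_well_defined R)
    (q : parameters R) (hq : Pfin q)
    (d : measure_display) (Omega : measurableType d)
    (P : probability Omega R) (A : Omega -> curves R)
    (hA : is_airy_wanderer q P A) :
  [/\ forall (v : R) (d' : measure_display) (Omega' : measurableType d')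
          (P' : probability Omega' R) (A' : Omega' -> curves R),
        is_airy_wanderer (translate q v) P' A' ->
        same_law P (fun w => add_const v (A w)) P' A',
      forall (d' : measure_display) (Omega' : measurableType d')
          (P' : probability Omega' R) (A' : Omega' -> curves R),
        is_airy_wanderer (swap_ab q) P' A' ->
        same_law P (fun w => reflect_time (A w)) P' A' &
      exists (q' : parameters R) (Delta : R),
        Ppos q' /\
        forall (d' : measure_display) (Omega' : measurableType d')
            (P' : probability Omega' R) (A' : Omega' -> curves R),
          is_airy_wanderer q' P' A' ->
          same_law P' (fun w => add_const (cp q) (delay Delta (A' w))) P A].
Proof.
have [vq cm0 _] := hq; split=> [v d' Omega' P' A' hA'|d' Omega' P' A' hA'|].
- apply: (well_defined _ (Pfin_translate v hq)).2 hA'.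
  exact: wanderer_translate.
- apply: (well_defined _ (Pfin_swap hq)).2 hA'.
  exact: wanderer_swap.
have [n [m [amn an bmm bn]]] := Pfin_finite hq.
have [D [mvA mvB]] := movable_exists vq an bn.
exists (plus_params q n m D), D; split; first exact: plus_params_Ppos.
move=> d' Omega' P' A' hA'; apply: (well_defined q hq).2 hA.
have hdelay := wanderer_delay_plus_params vq cm0 amn an bmm bn mvA mvB hA'.
(* The delayed ensemble has c^+ = 0; translation by [cp q] restores it. *)
have := @wanderer_translate _ _ _ _ (translate q (- cp q)) (cp q) _ erefl hdelay.
by rewrite (translateK cm0).
Qed.
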